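(* Assume the periodicity assumption and assumption (H) of the context, with its constant $\theta_0$, functions $V,\eta$ and probability measure $\nu$, and set $\eta_k:=\theta_0^{-k}P_k\eta$ for $k\in\mathbb Z_+$. Then there exists a constant $C<+\infty$ such that, for all measurable $f:E\to[-1,1]$, all probability measures $\mu$ on $E$ such that $\mu|_{A_i}(\eta_{t-i})>0$ for some $i\in\{0,\dots,t-1\}$ and $\mu|_{A_i}P_{t-i}V<+\infty$ for all $i\in\{0,\dots,t-1\}$, and all $N\ge0$, $$\left|\mathbb E_\mu\left[\frac1{N+1}\sum_{m=0}^Nf(X_m)\ \Big|\ N<\tau_\partial\right]-\frac{\theta_0^{-t}}{t}\sum_{\ell=0}^{t-1}\nu P_\ell(fP_{t-\ell}\eta)\right|\le\frac{C\,\sum_{i=0}^{t-1}\mu|_{A_i}P_{t-i}V}{(N+1)\,\sum_{i=0}^{t-1}\mu|_{A_i}(\eta_{t-i})}.$$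
   Context: Let $E$ be a measurable space, $\partial\notin E$, and let $(X_n)_{n\in\mathbb Z_+}$ be a Markov chain on $E\cup\{\partial\}$ for which $\partial$ is absorbing; $\mathbb P_x$ (resp. $\mathbb P_\mu$) is its law started from $x$ (resp. from the distribution $\mu$), with expectation $\mathbb E_x$ (resp. $\mathbb E_\mu$), and $\tau_\partial=\inf\{n\ge 0: X_n=\partial\}$. Its sub-Markov semigroup on $E$ is $P_nf(x)=\mathbb E_x(f(X_n)\mathbf 1_{n<\tau_\partial})$, $x\in E$, for measurable $f$ on $E$ that is nonnegative or satisfies $P_n|f|(x)<\infty$; for a positive measure $\mu$ on $E$, $\mu P_nf=\int_E P_nf\,d\mu$. $\mu|_{A}$ denotes the restriction $\mu(\cdot\cap A)$. Periodicity assumption: for a positive integer $t$, $E$ is the disjoint union of measurable sets $A_0,\dots,A_{t-1}$ such that for all $x\in A_i$, $P_1\mathbf 1_{A_j}(x)=0$ if $j\ne i+1$ and $P_1\mathbf 1_{A_j}(x)=P_1\mathbf 1_E(x)$ if $j=i+1$, with the convention $i+1=0$ if $i=t-1$. $Q_k:=P_{kt}$, $k\ge0$, acts on functions on $A_0$. Functions on $A_0$ (in particular $V$ and $\eta$) and measures on $A_0$ are extended by $0$ to $E\setminus A_0$. Assumption (H): there exist a measurable $V:A_0\to[1,+\infty)$, constants $\theta_0\in(0,1]$, $C_Q\in\mathbb R_+$, $\alpha\in(0,1)$, a nonzero measurable $\eta:A_0\to\mathbb R_+$ with $\eta/V$ bounded, and a probability measure $\nu$ on $A_0$ with $\nu(V)<+\infty$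 and $\nu(\eta)>0$, such that $$\left|\theta_0^{-kt}Q_kf(x)-\eta(x)\nu(f)\right|\le C_Q\,\alpha^k\,V(x)$$ for all measurable $f$ on $A_0$ with $|f|\le V$, all $k\ge0$ and all $x\in A_0$. *)

(* Defs.v *)
From HB Require Import structures.
From mathcomp Require Import all_boot all_order all_algebra.
From mathcomp Require Import all_classical all_reals all_analysis.
From mathcomp Require Import measurable_realfun.

Set Implicit Arguments.
Unset Strict Implicit.
Unset Printing Implicit Defensive.
Import Order.TTheory GRing.Theory Num.Theory.
Import numFieldNormedType.Exports.

Local Open Scope classical_set_scope.
Local Open Scope ring_scope.
Local Open Scope ereal_scope.

Definition cemetery_display (d : measure_display) : measure_display.
Proof. exact. Qed.

(* E with the cemetery point adjoined is [option E], the cemetery being [None].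
   A set B is measurable iff its trace on E is: both the measurable subsets of
   E and the singleton {None} are measurable in [option E]. *)
Section cemetery_measurable.
Context {d : measure_display} {E : measurableType d}.

Definition cemetery_measurable (B : set (option E)) : Prop :=
  measurable (Some @^-1` B).

Let cemetery_measurable0 : cemetery_measurable set0.
Proof. by rewrite /cemetery_measurable preimage_set0. Qed.

Let cemetery_measurableC B :
  cemetery_measurable B -> cemetery_measurable (~` B).
Proof. by rewrite /cemetery_measurable preimage_setC; exact: measurableC. Qed.

Let cemetery_measurable_bigcup (F : (set (option E))^nat) :
  (forall i, cemetery_measurable (F i)) ->
  cemetery_measurable (\bigcup_i F i).
Proof.
move=> mF; rewrite /cemetery_measurable preimage_bigcup.
by apply: bigcup_measurable => i _; exact: mF.
Qed.

HB.instance Definition _ := @isMeasurable.Build (cemetery_display d) (option E)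
  cemetery_measurable cemetery_measurable0 cemetery_measurableC
  cemetery_measurable_bigcup.

End cemetery_measurable.

(* Extension of a function on E by 0 at the cemetery. *)
Definition ext0 {T : Type} {R : realType} (f : T -> \bar R) (o : option T) :
  \bar R := if o is Some x then f x else 0.

Section chain.
Context {dE dO : measure_display} {E : measurableType dE}
  {Omega : measurableType dO} {R : realType}.
Variables (X : nat -> Omega -> option E) (P : R.-pker (option E) ~> Omega).

Definition history (n : nat) : set (set Omega) :=
  <<s \bigcup_(k in [set k | (k <= n)%N])
        preimage_set_system setT (X k) measurable >>.

(* [P x] is the law under which the chain starts from [x]. *)
Record absorbed_markov_chain : Prop := {
  chain_measurable : forall n, measurable_fun setT (X n) ;
  chain_start : forall x B, measurable B -> P x (X 0%N @^-1` B) = \d_x B ;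
  chain_markov : forall x n H B, history n H -> measurable B ->
    P x (H `&` X n.+1 @^-1` B) = \int[P x]_(w in H) P (X n w) (X 1%N @^-1` B) ;
  chain_absorbing : P None (X 1%N @^-1` [set None]) = 1
}.

Definition tau (w : Omega) : \bar R :=
  ereal_inf [set n%:R%:E | n in [set n | X n w = None]].

Definition alive (n : nat) : set Omega := [set w | n%:R%:E < tau w].

Definition semigroup (n : nat) (f : E -> \bar R) (x : E) : \bar R :=
  \int[P (Some x)]_(w in alive n) ext0 f (X n w).

End chain.
Arguments tau {dE dO E Omega} R X w.
Arguments alive {dE dO E Omega} R X n.

Section initial_law.
Context {dE dO : measure_display} {E : measurableType dE}
  {Omega : measurableType dO} {R : realType}.
Variables (P : R.-pker (option E) ~> Omega) (mu : probability E R).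

(* The law of the chain with initial distribution [mu]. *)
Definition initial_law (H : set Omega) : \bar R := \int[mu]_x P (Some x) H.

Let measurable_law_integrand H : measurable H ->
  measurable_fun setT (fun x => P (Some x) H).
Proof.
move=> mH; apply: (measurableT_comp (measurable_kernel P H mH)).
by move=> _ B mB; rewrite setTI.
Qed.

Let law0 : initial_law set0 = 0.
Proof. by rewrite /initial_law integral0_eq// => x _; rewrite measure0. Qed.

Let law_ge0 H : 0 <= initial_law H.
Proof. exact: integral_ge0. Qed.

Let law_sigma_additive : semi_sigma_additive initial_law.
Proof.
move=> U mU tU mUU; rewrite [X in _ --> X](_ : _ =
  \int[mu]_x (\sum_(n <oo) P (Some x) (U n))); last first.
  apply: eq_integral => x _.
  by apply/esym/cvg_lim => //; exact/measure_semi_sigma_additive.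
apply/cvg_closeP; split.
  by apply: is_cvg_nneseries => n _ _; exact: integral_ge0.
rewrite closeE// integral_nneseries// => n.
exact: measurable_law_integrand.
Qed.

HB.instance Definition _ :=
  isMeasure.Build _ _ R initial_law law0 law_ge0 law_sigma_additive.

Let law_setT : initial_law setT = 1.
Proof.
rewrite /initial_law (eq_integral (cst 1)); last first.
  by move=> x _; rewrite prob_kernel.
by rewrite integral_cst// [X in _ * X](probability_setT mu) mule1.
Qed.

HB.instance Definition _ :=
  Measure_isProbability.Build _ _ R initial_law law_setT.

End initial_law.

(* Expectation conditional on an event of positive probability. *)
Definition cond_expectation {d : measure_display} {T : measurableType d}
    {R : realType} (Q : probability T R) (Y : T -> \bar R) (H : set T) :
    \bar R :=
  (\int[Q]_(w in H) Y w) / Q H.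

Section assumptions.
Context {dE dO : measure_display} {E : measurableType dE}
  {Omega : measurableType dO} {R : realType}.
Variables (X : nat -> Omega -> option E) (P : R.-pker (option E) ~> Omega).
Variables (t : nat) (A : nat -> set E).

(* Only the values [A 0], ..., [A t.-1] are relevant. *)
Record periodicity : Prop := {
  period_gt0 : (0 < t)%N ;
  class_measurable : forall i, (i < t)%N -> measurable (A i) ;
  class_disjoint : trivIset `I_t A ;
  class_cover : \bigcup_(i in `I_t) A i = setT ;
  class_next : forall i j x, (i < t)%N -> (j < t)%N -> A i x ->
    semigroup X P 1 (EFin \o \1_(A j)) x =
      if j == (i.+1 %% t)%N then semigroup X P 1 (cst 1) x else 0
}.

(* Functions on [A 0] are functions on E vanishing off [A 0]; for the test
   function f below this follows from |f| <= V. A measure on [A 0] is a measure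
   on E giving no mass to the complement of [A 0]. *)
Record assumptionH (V eta : E -> R) (theta0 CQ alpha : R)
    (nu : probability E R) : Prop := {
  V_measurable : measurable_fun setT V ;
  V_ge1 : forall x, A 0%N x -> (1 <= V x)%R ;
  V_off : forall x, ~ A 0%N x -> V x = 0%R ;
  theta0_gt0 : (0 < theta0)%R ;
  theta0_le1 : (theta0 <= 1)%R ;
  CQ_ge0 : (0 <= CQ)%R ;
  alpha_gt0 : (0 < alpha)%R ;
  alpha_lt1 : (alpha < 1)%R ;
  eta_measurable : measurable_fun setT eta ;
  eta_ge0 : forall x, (0 <= eta x)%R ;
  eta_off : forall x, ~ A 0%N x -> eta x = 0%R ;
  eta_neq0 : exists x, eta x != 0%R ;
  eta_V_bounded : exists M : R, forall x, A 0%N x -> (eta x / V x <= M)%R ;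
  nu_off : nu (~` A 0%N) = 0 ;
  nu_V : \int[nu]_x (V x)%:E < +oo ;
  nu_eta : 0 < \int[nu]_x (eta x)%:E ;
  geometric_convergence : forall (f : E -> R) (k : nat) (x : E),
    measurable_fun setT f -> (forall y, (`|f y| <= V y)%R) -> A 0%N x ->
    `| (theta0 ^- (k * t))%:E * semigroup X P (k * t) (EFin \o f) x
       - (eta x)%:E * \int[nu]_y (f y)%:E |
    <= (CQ * alpha ^+ k * V x)%:E
}.

Definition eta_ (eta : E -> R) (theta0 : R) (k : nat) (x : E) : \bar R :=
  (theta0 ^- k)%:E * semigroup X P k (EFin \o eta) x.

End assumptions.

(* Main.v *)
(* Write P_n for the killed semigroup. On A_0, assumption (H) says that P_{kt} g is
   theta0^{kt} nu(g) eta up to an error theta0^{kt} alpha^k V. Fix x in A_i, put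
   s = t - i and N = s + kt + r with r < t, and split a time m in [s, s + kt) as
   m = s + jt + l. The Markov property gives
     E_x[f(X_m); N < tau] = P_s P_{jt} P_l (f P_{t-l} P_{nt} P_r 1)(x), j + n + 1 = k,
   and applying (H) at the two long stretches P_{nt} and P_{jt} turns this into
   theta0^{(k-1)t} nu(P_r 1) nu(P_l (f P_{t-l} eta)) P_s eta(x), up to an error of
   order theta0^{kt} (alpha^j + alpha^n) P_s V(x). The errors are summable in m, and
   the at most 2t remaining times cost O(P_x(N < tau)), so that
   E_x[sum_m f(X_m); N < tau] = (N+1) L P_x(N < tau) + O(theta0^N P_s V(x)), where L
   is the announced limit. One integrates against mu and divides by
   P_mu(N < tau), which is at least c theta0^N mu(eta) up to O(theta0^N mu(V)/(N+1)).

   All estimates are two-sided inequalities without subtraction between nonnegative,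
   possibly infinite functions, so no integrability has to be tracked; signs only
   enter at the end, through the positive and negative parts of f. *)
Require Import Defs.
From mathcomp Require Import all_boot all_order all_algebra.
From mathcomp Require Import all_classical all_reals all_analysis.
From mathcomp Require Import measurable_realfun.
From mathcomp Require Import ring lra.
Import Order.TTheory GRing.Theory Num.Theory.

Local Open Scope classical_set_scope.
Local Open Scope ring_scope.
Local Open Scope ereal_scope.

(** * Positive functionals on nonnegative measurable functions *)

Section positive_functionals.
Import HBNNSimple.
Context {d} {T : measurableType d} {R : realType}.
Implicit Types (f g : T -> \bar R) (J : (T -> \bar R) -> \bar R).

Definition nnmfun f := (forall x, 0 <= f x) /\ measurable_fun setT f.

(** The properties shared by integrals, evaluations and the killed semigroup at a point. They make
    sense with infinite values, and monotone continuity lets two such functionals be compared on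
    indicators alone. *)
Record integral_like J : Prop := {
  il_ge0 : forall f, nnmfun f -> 0 <= J f ;
  il_le : forall f g, nnmfun f -> nnmfun g -> (forall x, f x <= g x) ->
    J f <= J g ;
  il_D : forall f g, nnmfun f -> nnmfun g -> J (f \+ g) = J f + J g ;
  il_Z : forall (c : R) f, (0 <= c)%R -> nnmfun f ->
    J (fun x => c%:E * f x) = c%:E * J f ;
  il_lim : forall f_ : (T -> \bar R)^nat, (forall n, nnmfun (f_ n)) ->
    (forall x, nondecreasing_seq (f_ ^~ x)) ->
    J (fun x => limn (f_ ^~ x)) = limn (fun n => J (f_ n)) }.

Lemma nnmfunD f g : nnmfun f -> nnmfun g -> nnmfun (f \+ g).
Proof.
move=> [f0 mf] [g0 mg]; split; first by move=> x; exact: adde_ge0.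
exact: emeasurable_funD.
Qed.

Lemma nnmfunM f g : nnmfun f -> nnmfun g -> nnmfun (f \* g).
Proof.
move=> [f0 mf] [g0 mg]; split; first by move=> x; exact: mule_ge0.
exact: emeasurable_funM.
Qed.

Lemma nnmfunZ (c : R) f : (0 <= c)%R -> nnmfun f ->
  nnmfun (fun x => c%:E * f x).
Proof.
move=> c0 [f0 mf]; split; first by move=> x; exact: mule_ge0.
exact: measurable_funeM.
Qed.

Lemma nnmfun_cst (c : R) : (0 <= c)%R -> nnmfun (cst c%:E).
Proof. by move=> c0; split. Qed.

Lemma nnmfun_indic (B : set T) : measurable B -> nnmfun (EFin \o \1_B).
Proof.
by move=> mB; split; [move=> x; rewrite lee_fin|exact/measurable_EFinP].
Qed.

Lemma nnmfun_lim (f_ : (T -> \bar R)^nat) : (forall n, nnmfun (f_ n)) ->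
  (forall x, nondecreasing_seq (f_ ^~ x)) ->
  nnmfun (fun x => limn (f_ ^~ x)).
Proof.
move=> f_P nd; split => [x|].
  apply: lime_ge; first exact: ereal_nondecreasing_is_cvgn.
  by apply: nearW => n; case: (f_P n).
(* The limit of a monotone sequence is its limsup, whose measurability is known. *)
rewrite (_ : (fun _ => _) = fun x => limn_esup (f_ ^~ x)); last first.
  apply/funext => x; rewrite is_cvg_limn_esupE//.
  exact: ereal_nondecreasing_is_cvgn.
by apply: measurable_fun_limn_esup => n; case: (f_P n).
Qed.

Lemma nnmfun_sum (I : Type) (s : seq I) (h : I -> T -> \bar R) :
  (forall i, nnmfun (h i)) -> nnmfun (fun x => \sum_(i <- s) h i x).
Proof.
move=> hP; split => [x|]; first by apply: sume_ge0 => i _; case: (hP i).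
by apply: emeasurable_sum => i; case: (hP i).
Qed.

(* Simple functions approximate from below, so an integral-like functional is
   determined by its values on indicators. *)
Lemma eq_integral_like J1 J2 : integral_like J1 -> integral_like J2 ->
  (forall B, measurable B -> J1 (EFin \o \1_B) = J2 (EFin \o \1_B)) ->
  forall f, nnmfun f -> J1 f = J2 f.
Proof.
move=> h1 h2 h f [f0 mf].
pose f_ := nnsfun_approx measurableT mf.
have f_P n : nnmfun (EFin \o f_ n).
  by split; [move=> x; rewrite lee_fin|exact/measurable_EFinP].
have nd x : nondecreasing_seq ((fun n => EFin \o f_ n) ^~ x).
  by move=> m n mn; rewrite /= lee_fin; exact/lefP/nd_nnsfun_approx.
have -> : f = (fun x => limn ((fun n => EFin \o f_ n) ^~ x)).
  by apply/funext => x; apply/esym/cvg_lim => //; exact: cvg_nnsfun_approx.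
rewrite (il_lim _ h1)// (il_lim _ h2)//; congr (limn _); apply/funext => n.
suff H (s : seq R) (g : R -> set T) : (forall r, r \in s -> (0 <= r)%R) ->
    (forall r, measurable (g r)) ->
    nnmfun (fun x => \sum_(r <- s) (r%:E * (\1_(g r) x)%:E)) /\
    J1 (fun x => \sum_(r <- s) (r%:E * (\1_(g r) x)%:E)) =
    J2 (fun x => \sum_(r <- s) (r%:E * (\1_(g r) x)%:E)).
  (* The filter supplies the hypothesis [0 <= r] of the list induction; the discarded values are
     negative, so their preimages under [f_ n] are empty. *)
  pose s := [seq r <- finmap.enum_fset (fset_set (range (f_ n))) | (0 <= r)%R].
  have -> : (EFin \o f_ n) = (fun x => \sum_(r <- s) (r%:E * (\1_(f_ n @^-1` [set r]) x)%:E)).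
    apply/funext => x /=; rewrite fimfunE fsbig_finite//= -sumEFin.
    rewrite big_filter [RHS]big_mkcond/=; apply: eq_bigr => r _.
    case: ifPn => [r0|]; first by rewrite EFinM.
    by rewrite -ltNge => r0; rewrite preimage_nnfun0// indic0 mulr0.
  apply: (H s (fun r => f_ n @^-1` [set r]) _ _).2 => //.
  by move=> r; rewrite mem_filter => /andP[].
move=> + mg; elim: s => [_|r s ih s0].
  under eq_fun do rewrite big_nil.
  split; first exact: (nnmfun_cst 0).
  (* The zero function is written as a multiple by 0, so that homogeneity gives it the value 0. *)
  rewrite -[fun _ : T => _]/(cst 0) (_ : cst 0 = fun x : T => 0%:E * cst 0 x).
    by rewrite (il_Z _ h1)// (il_Z _ h2)// !mul0e.
  by apply/funext => x; rewrite mul0e.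
have [|nns ihs] := ih; first by move=> r' r's; rewrite s0// inE r's orbT.
have r0 : (0 <= r)%R by rewrite s0// inE eqxx.
under eq_fun do rewrite big_cons.
have nnr : nnmfun (fun x => r%:E * (\1_(g r) x)%:E).
  by apply: nnmfunZ => //; exact: nnmfun_indic.
split; first exact: (nnmfunD _ _ nnr nns).
have := il_D _ h1 _ _ nnr nns; have := il_D _ h2 _ _ nnr nns.
rewrite /= => -> ->; rewrite ihs; congr (_ + _).
have := il_Z _ h1 _ _ r0 (nnmfun_indic _ (mg r)).
have := il_Z _ h2 _ _ r0 (nnmfun_indic _ (mg r)).
by rewrite /= => -> ->; rewrite h.
Qed.

End positive_functionals.
Arguments il_ge0 {d T R J}.
Arguments il_le {d T R J}.
Arguments il_D {d T R J}.
Arguments il_Z {d T R J}.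
Arguments il_lim {d T R J}.

(** * Integrals as integral-like functionals *)

Section integral_like_integrals.
Context {d d'} {T : measurableType d} {Y : measurableType d'} {R : realType}.
Context (m : {measure set Y -> \bar R}) (D : set Y).
Hypothesis mD : measurable D.

(** Monotone convergence in the outer variable makes a mixture of integral-like functionals
    integral-like. This covers the iterated kernel integrals of the Markov property. *)
Lemma integral_like_nested (J : Y -> (T -> \bar R) -> \bar R) :
  (forall y, D y -> integral_like (J y)) ->
  (forall f, nnmfun f -> measurable_fun D (J ^~ f)) ->
  integral_like (fun f => \int[m]_(y in D) J y f).
Proof.
move=> JP mJ; split.
- by move=> f fP; apply: integral_ge0 => y Dy; exact: (il_ge0 (JP y Dy)).
- move=> f g fP gP fg; apply: ge0_le_integral => //.
  + by move=> y Dy; exact: (il_ge0 (JP y Dy)).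
  + exact: mJ.
  + exact: mJ.
  + by move=> y Dy; exact: (il_le (JP y Dy)).
- move=> f g fP gP; rewrite -ge0_integralD//.
  + by apply: eq_integral => y /[!inE] Dy; exact: (il_D (JP y Dy)).
  + by move=> y Dy; exact: (il_ge0 (JP y Dy)).
  + exact: mJ.
  + by move=> y Dy; exact: (il_ge0 (JP y Dy)).
  + exact: mJ.
- move=> c f c0 fP; rewrite -ge0_integralZl//.
  + by apply: eq_integral => y /[!inE] Dy; exact: (il_Z (JP y Dy)).
  + exact: mJ.
  + by move=> y Dy; exact: (il_ge0 (JP y Dy)).
- move=> f_ f_P nd; rewrite -monotone_convergence//.
  + by apply: eq_integral => y /[!inE] Dy; exact: (il_lim (JP y Dy)).
  + by move=> n; exact: mJ.
  + by move=> n y Dy; exact: (il_ge0 (JP y Dy)).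
  + by move=> y Dy a b ab; apply: (il_le (JP y Dy)) => // x; exact: nd.
Qed.

Lemma integral_like_eval (y : Y) (c : \bar R) (phi : Y -> T) : 0 <= c ->
  c \is a fin_num ->
  integral_like (fun f => f (phi y) * c).
Proof.
move=> c0 cfin; split.
- by move=> f [f0 _]; exact: mule_ge0.
- by move=> f g [f0 _] [g0 _] fg; exact: lee_wpmul2r.
- by move=> f g [f0 _] [g0 _]; rewrite ge0_muleDl.
- by move=> k f k0 [f0 _]; rewrite muleA.
- move=> f_ f_P nd; rewrite limeMr//; exact: ereal_nondecreasing_is_cvgn.
Qed.

End integral_like_integrals.

Section integral_like_comp.
Context {d d'} {T : measurableType d} {Y : measurableType d'} {R : realType}.

Lemma integral_like_comp (m : {measure set Y -> \bar R}) (D : set Y)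
    (phi : Y -> T) (h : Y -> \bar R) :
  measurable D -> measurable_fun setT phi -> nnmfun h ->
  (forall y, h y \is a fin_num) ->
  integral_like (fun f => \int[m]_(y in D) (f (phi y) * h y)).
Proof.
move=> mD mphi [h0 mh] hfin.
apply: (integral_like_nested m D mD (fun y f => f (phi y) * h y)).
  by move=> y _; apply: integral_like_eval.
move=> f [_ mf]; apply: measurable_funTS.
by apply: emeasurable_funM => //; exact: measurableT_comp.
Qed.

Lemma integral_like_comp1 (m : {measure set Y -> \bar R}) (D : set Y)
    (phi : Y -> T) : measurable D -> measurable_fun setT phi ->
  integral_like (fun f => \int[m]_(y in D) f (phi y)).
Proof.
move=> mD mphi.
rewrite (_ : (fun f => _) =
    fun f => \int[m]_(y in D) (f (phi y) * cst 1%:E y)).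
  by apply: integral_like_comp => //; exact: nnmfun_cst.
by apply/funext => f; apply: eq_integral => y _; rewrite mule1.
Qed.

Lemma nnmfun_comp (phi : Y -> T) (f : T -> \bar R) :
  measurable_fun setT phi -> nnmfun f -> nnmfun (f \o phi).
Proof.
by move=> mphi [f0 mf]; split; [move=> y; exact: f0|exact: measurableT_comp].
Qed.

End integral_like_comp.

Lemma in_preimage {T U : Type} (phi : T -> U) (B : set U) (x : T) :
  (x \in phi @^-1` B) = (phi x \in B).
Proof. by []. Qed.

Lemma integral_indic_comp {d d'} {T : measurableType d} {Y : measurableType d'}
    {R : realType} (m : {measure set Y -> \bar R}) (D : set Y) (phi : Y -> T)
    (B : set T) : measurable D -> measurable_fun setT phi -> measurable B ->
  \int[m]_(y in D) (EFin \o \1_B) (phi y) = m (D `&` phi @^-1` B).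
Proof.
move=> mD mphi mB.
rewrite (eq_integral (EFin \o \1_(phi @^-1` B)))//.
have mp : measurable (phi @^-1` B) by rewrite -[X in measurable X]setTI; exact: mphi.
by rewrite integral_indic// setIC.
Qed.

(** * The Markov property and the killed semigroup *)

Section cemetery.
Context {d} {E : measurableType d} {R : realType}.

Lemma measurable_Some : measurable_fun setT (@Some E).
Proof. by move=> _ B mB; rewrite setTI. Qed.

Lemma measurable_notNone : measurable [set~ @None E].
Proof.
change (measurable (Some @^-1` [set~ @None E])).
by rewrite (_ : _ @^-1` _ = setT)//; apply/seteqP; split.
Qed.

Lemma nnmfun_ext0 (f : E -> \bar R) : nnmfun f -> nnmfun (ext0 f).
Proof.
move=> [f0 mf]; split; first by case.
move=> _ B mB; rewrite setTI.
by have := mf measurableT B mB; rewrite setTI.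
Qed.

Lemma ext0M (f g : E -> \bar R) o : ext0 (f \* g) o = ext0 f o * ext0 g o.
Proof. by case: o => //=; rewrite mule0. Qed.

End cemetery.

Section chain.
Context {dE dO : measure_display} {E : measurableType dE}
  {Omega : measurableType dO} {R : realType}.
Context (X : nat -> Omega -> option E) (P : R.-pker (option E) ~> Omega).
Hypothesis XP : absorbed_markov_chain X P.

Let mX n : measurable_fun setT (X n) := chain_measurable XP n.

Lemma aliveE n : alive R X n = [set w | forall m, (m <= n)%N -> X m w <> None].
Proof.
rewrite /alive /tau; apply/seteqP; split => w /= => [+ m mn Xm|Xn].
  apply/negP; rewrite -leNgt; apply: (@le_trans _ _ m%:R%:E).
    by apply: ereal_inf_lbound; exists m.
  by rewrite lee_fin ler_nat.
(* Every hitting time of the cemetery is at least n+1, hence so is their infimum (+oo if there is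
   none); this makes the inequality strict. *)
apply: (@lt_le_trans _ _ n.+1%:R%:E); first by rewrite lte_fin ltr_nat.
apply: le_ereal_inf_tmp => _ [m /= Xm <-].
by rewrite lee_fin ler_nat ltnNge; apply/negP => /Xn.
Qed.

Lemma aliveS n : alive R X n.+1 = alive R X n `&` X n.+1 @^-1` [set~ None].
Proof.
rewrite !aliveE; apply/seteqP; split => w /= => [Xn|[Xn XSn] m].
  by split => [m mn|]; apply: Xn => //; exact: leqW.
by rewrite leq_eqVlt => /predU1P[->//|]; exact: Xn.
Qed.

Lemma alive0 : alive R X 0 = X 0%N @^-1` [set~ None].
Proof.
rewrite aliveE; apply/seteqP; split => w /= => [|X0 m]; first exact.
by rewrite leqn0 => /eqP ->.
Qed.

Lemma history_measurable n H : history X n H -> measurable H.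
Proof.
apply: smallest_sub; first exact: sigma_algebra_measurable.
by move=> A [k _ [B mB <-]]; exact: mX.
Qed.

Lemma historyI n H K : history X n H -> history X n K -> history X n (H `&` K).
Proof. exact: (@measurableI _ (g_sigma_algebraType _)). Qed.

Lemma historyS n H : history X n H -> history X n.+1 H.
Proof.
apply: sub_sigma_algebra2 => A [k kn XA]; exists k => //.
exact: leqW.
Qed.

Lemma history_preimage m n B : (m <= n)%N -> measurable B ->
  history X n (X m @^-1` B).
Proof.
move=> mn mB; apply: sub_sigma_algebra; exists m => //.
by exists B => //; rewrite setTI.
Qed.

Lemma history_alive n : history X n (alive R X n).
Proof.
elim: n => [|n ih].
  by rewrite alive0; apply: history_preimage => //; exact: measurable_notNone.
rewrite aliveS; apply: historyI; first exact: historyS.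
by apply: history_preimage => //; exact: measurable_notNone.
Qed.

Lemma measurable_alive n : measurable (alive R X n).
Proof. exact: history_measurable (history_alive n). Qed.

Lemma nnmfun_integral_kernel (G : Omega -> \bar R) : nnmfun G ->
  nnmfun (fun y => \int[P y]_w G w).
Proof.
move=> [G0 mG]; split; first by move=> y; exact: integral_ge0.
by apply: measurable_fun_integral_kernel => // U mU; exact: measurable_kernel.
Qed.

(** Both sides are integral-like in [G], and on indicators the claim is [chain_markov]. *)
Lemma markov_integral x n H (G : option E -> \bar R) :
  history X n H -> nnmfun G ->
  \int[P x]_(w in H) G (X n.+1 w) =
  \int[P x]_(w in H) \int[P (X n w)]_v G (X 1%N v).
Proof.
move=> hH; have mH := history_measurable _ _ hH.
pose J1 f := \int[P x]_(w in H) f (X n.+1 w).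
pose J2 f := \int[P x]_(w in H) \int[P (X n w)]_v f (X 1%N v).
apply: (@eq_integral_like _ _ _ J1 J2).
- exact: integral_like_comp1.
- apply: (@integral_like_nested _ _ _ _ _ _ H mH
    (fun w f => \int[P (X n w)]_v f (X 1%N v))).
    by move=> w _; exact: integral_like_comp1.
  move=> f fP; apply: measurable_funTS.
  have [_] := nnmfun_comp _ _ (mX n)
    (nnmfun_integral_kernel (f \o X 1%N) (nnmfun_comp _ _ (mX 1%N) fP)).
  exact.
- move=> B mB; rewrite /J1 /J2 integral_indic_comp// (chain_markov XP)//.
  by apply: eq_integral => w _; rewrite integral_indic_comp// setTI.
Qed.

Lemma start_integral x (G : option E -> \bar R) : nnmfun G ->
  \int[P x]_w G (X 0%N w) = G x.
Proof.
move=> GP; rewrite -[RHS]mule1; move: G GP.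
apply: (@eq_integral_like _ _ _ (fun G => \int[P x]_w G (X 0%N w))
  (fun G => G x * 1)).
- exact: integral_like_comp1.
- exact: (integral_like_eval (T := option E) x 1 id).
- move=> B mB; rewrite integral_indic_comp// setTI (chain_start XP)//.
  by rewrite mule1.
Qed.

(** The one-step killed operator P_1: since [ext0 g] vanishes at the cemetery, no restriction to
    survival is written. *)
Definition step (g : E -> \bar R) (y : E) : \bar R :=
  \int[P (Some y)]_v ext0 g (X 1%N v).

Lemma nnmfun_step g : nnmfun g -> nnmfun (step g).
Proof.
move=> gP; apply: (nnmfun_comp Some _ measurable_Some
  (nnmfun_integral_kernel _ _)).
exact: (nnmfun_comp _ _ (mX 1%N) (nnmfun_ext0 _ gP)).
Qed.

Lemma integral_aliveS x n (G : Omega -> \bar R) :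
  (forall w, X n.+1 w = None -> G w = 0) ->
  \int[P x]_(w in alive R X n.+1) G w = \int[P x]_(w in alive R X n) G w.
Proof.
move=> G0; rewrite integral_mkcond [RHS]integral_mkcond; congr (integral _ _ _).
apply/funext => w; rewrite /patch; case: ifPn => [|].
  by rewrite aliveS inE => -[aw _]; rewrite mem_set.
rewrite notin_setE aliveS => /not_andP aw; case: ifPn => //; rewrite inE => wn.
by rewrite G0//; case: aw => // /contrapT.
Qed.

Lemma semigroup0 g : nnmfun g -> semigroup X P 0 g = g.
Proof.
move=> gP; apply/funext => x; rewrite /semigroup -[RHS]/(ext0 g (Some x)).
rewrite -(start_integral _ _ (nnmfun_ext0 _ gP)) integral_mkcond.
congr (integral _ _ _); apply/funext => w; rewrite /patch alive0; case: ifPn => //.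
by rewrite notin_setE => /contrapT ->.
Qed.

(** Markov property at time [n]: survival up to [n] belongs to the history, and death at time n+1 is
    accounted for by [ext0 g]. *)
Lemma semigroup_step n g : nnmfun g ->
  semigroup X P n.+1 g = semigroup X P n (step g).
Proof.
move=> gP; apply/funext => x; rewrite /semigroup integral_aliveS; last first.
  by move=> w ->.
rewrite markov_integral; [|exact: history_alive|exact: nnmfun_ext0].
apply: eq_integral => w; rewrite inE aliveE => /(_ n (leqnn n)).
by case: (X n w).
Qed.

Lemma semigroupE n g : nnmfun g -> semigroup X P n g = iter n step g.
Proof.
elim: n g => [|n ih] g gP; first exact: semigroup0.
by rewrite semigroup_step// ih ?iterSr//; exact: nnmfun_step.
Qed.

Lemma nnmfun_semigroup n g : nnmfun g -> nnmfun (semigroup X P n g).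
Proof.
move=> gP; rewrite semigroupE//.
by elim: n => //= n ih; exact: nnmfun_step.
Qed.

Lemma semigroup_add m n g : nnmfun g ->
  semigroup X P (m + n) g = semigroup X P m (semigroup X P n g).
Proof.
move=> gP; rewrite semigroupE// iterD semigroupE; last exact: nnmfun_semigroup.
by rewrite semigroupE.
Qed.

Lemma semigroup_integral_like n x : integral_like (semigroup X P n ^~ x).
Proof.
have h : integral_like
    (fun f => \int[P (Some x)]_(w in alive R X n) f (X n w)).
  by apply: integral_like_comp1 => //; exact: measurable_alive.
split.
- by move=> f /nnmfun_ext0/(il_ge0 h).
- move=> f g /nnmfun_ext0 fP /nnmfun_ext0 gP fg; apply: (il_le h) => //.
  by case=> //=.
- move=> f g /nnmfun_ext0 fP /nnmfun_ext0 gP; rewrite -(il_D h _ _ fP gP).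
  by apply: eq_integral => w _; case: (X n w) => //=; rewrite adde0.
- move=> c f c0 /nnmfun_ext0 fP; rewrite -(il_Z h _ _ c0 fP).
  by apply: eq_integral => w _; case: (X n w) => //=; rewrite mule0.
- move=> f_ f_P nd; rewrite -(il_lim h (fun n => ext0 (f_ n))).
  + apply: eq_integral => w _; case: (X n w) => //=.
    by apply/esym/cvg_lim => //; exact: cvg_cst.
  + by move=> k; exact: nnmfun_ext0.
  + by case=> // y a b; exact: nd.
Qed.

(** Induction on [k]: the last step is integrated out, which replaces [h] by [step h]. The bound
    [h <= 1] is preserved and keeps the second factor finite, so that the integral is integral-like
    in the first factor. *)
Lemma two_time_integral m k x (f h : E -> \bar R) : nnmfun f -> nnmfun h ->
  (forall y, h y <= 1) ->
  \int[P (Some x)]_(w in alive R X (m + k))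
    (ext0 f (X m w) * ext0 h (X (m + k)%N w)) =
  semigroup X P m (f \* semigroup X P k h) x.
Proof.
move=> fP; elim: k h => [|k ih] h hP h1.
  rewrite addn0 semigroup0//; apply: eq_integral => w _.
  by rewrite ext0M.
have sh1 y : step h y <= 1.
  rewrite -[leRHS](prob_kernel (Some y) (s := P)) -[leRHS]mul1e.
  rewrite -[leRHS]integral_cst//; apply: ge0_le_integral => //.
  + by move=> w _; apply: (nnmfun_ext0 _ hP).1.
  + by have [_] := nnmfun_comp _ _ (mX 1%N) (nnmfun_ext0 _ hP).
  + by move=> w _ /=; case: (X 1%N w) => //=; rewrite ?h1.
have sP := nnmfun_step _ hP.
rewrite semigroup_step// -ih// addnS integral_aliveS; last first.
  by move=> w ->; rewrite mule0.
have bnd (u : E -> \bar R) o : nnmfun u -> (forall y, u y <= 1) ->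
    ext0 u o \is a fin_num.
  move=> [u0 _] u1; case: o => //= y.
  by rewrite ge0_fin_numE// (le_lt_trans (u1 y))// ltry.
have mA := measurable_alive (m + k).
(* Generalizing [ext0 f] to any nonnegative function of [X m] reduces the identity to indicators. *)
move: (ext0 f) (nnmfun_ext0 _ fP).
apply: (@eq_integral_like _ _ _
  (fun F => \int[P (Some x)]_(w in alive R X (m + k))
     (F (X m w) * ext0 h (X (m + k).+1 w)))
  (fun F => \int[P (Some x)]_(w in alive R X (m + k))
     (F (X m w) * ext0 (step h) (X (m + k)%N w)))).
- apply: integral_like_comp => //; last by move=> y; exact: bnd.
  exact: (nnmfun_comp _ _ (mX _) (nnmfun_ext0 _ hP)).
- apply: integral_like_comp => //; last by move=> y; exact: bnd.
  exact: (nnmfun_comp _ _ (mX _) (nnmfun_ext0 _ sP)).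
- move=> B mB.
  (* An indicator of [X m] turns into a restriction of the domain to an event of the history at time
     m+k, where the Markov property applies. *)
  have indicR (v : Omega -> \bar R) :
      \int[P (Some x)]_(w in alive R X (m + k)) ((EFin \o \1_B) (X m w) * v w) =
      \int[P (Some x)]_(w in alive R X (m + k) `&` X m @^-1` B) v w.
    rewrite integral_mkcondr; apply: eq_integral => w _; rewrite /patch /=.
    rewrite indicE in_preimage; case: ifPn => _; by rewrite ?mul1e ?mul0e.
  rewrite !indicR markov_integral; last 2 first.
  + apply: historyI; first exact: history_alive.
    by apply: history_preimage => //; exact: leq_addr.
  + exact: nnmfun_ext0.
  apply: eq_integral => w; rewrite inE aliveE => -[/(_ _ (leqnn _)) + _].
  by case: (X (m + k)%N w).
Qed.


Lemma prob_alive n x : P (Some x) (alive R X n) = semigroup X P n (cst 1) x.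
Proof.
rewrite -[LHS]mul1e -integral_cst//; last exact: measurable_alive.
apply: eq_integral => w; rewrite inE aliveE => /(_ n (leqnn n)) /=.
by case: (X n w).
Qed.

Lemma alive_integral m k x f : nnmfun f ->
  \int[P (Some x)]_(w in alive R X (m + k)) ext0 f (X m w) =
  semigroup X P m (f \* semigroup X P k (cst 1)) x.
Proof.
move=> fP; rewrite -two_time_integral//.
apply: eq_integral => w; rewrite inE aliveE => /(_ _ (leqnn _)) /=.
by case: (X (m + k)%N w) => [y|]//= _; rewrite mule1.
Qed.

Lemma initial_law_integral (mu : probability E R) D (G : Omega -> \bar R) :
  measurable D -> nnmfun G ->
  \int[initial_law P mu]_(w in D) G w =
  \int[mu]_x \int[P (Some x)]_(w in D) G w.
Proof.
move=> mD.
apply: (@eq_integral_like _ _ _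
  (fun G => \int[initial_law P mu]_(w in D) G w)
  (fun G => \int[mu]_x \int[P (Some x)]_(w in D) G w)).
- exact: (integral_like_comp1 _ _ id).
- apply: (@integral_like_nested _ _ _ _ _ _ setT measurableT
    (fun x G => \int[P (Some x)]_(w in D) G w)).
    by move=> x _; exact: (integral_like_comp1 _ _ id).
  move=> f fP; have fDP : nnmfun (f \_ D).
    split; first by move=> w; apply: erestrict_ge0 => v _; case: fP.
    by apply: (measurable_restrictT _ _).1 => //; apply: measurable_funTS; case: fP.
  under eq_fun do rewrite integral_mkcond.
  exact: (nnmfun_comp _ _ measurable_Some (nnmfun_integral_kernel _ fDP)).2.
- move=> B mB.
  rewrite (integral_indic_comp _ _ id)//.
  rewrite -[LHS]/(\int[mu]_x P (Some x) (D `&` id @^-1` B)).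
  by apply: eq_integral => x _; rewrite (integral_indic_comp _ _ id).
Qed.

End chain.

(** * Finite sums and null sets for integral-like functionals *)

Section integral_like_theory.
Context {d} {T : measurableType d} {R : realType}.
Context (J : (T -> \bar R) -> \bar R).
Hypothesis JP : integral_like J.

Lemma il_sum (I : Type) (s : seq I) (h : I -> T -> \bar R) :
  (forall i, nnmfun (h i)) ->
  J (fun x => \sum_(i <- s) h i x) = \sum_(i <- s) J (h i).
Proof.
move=> hP; elim: s => [|i s ih].
  rewrite big_nil (_ : (fun _ => _) = fun x => 0%:E * cst 0 x); last first.
    by apply/funext => x; rewrite big_nil mul0e.
  by rewrite (il_Z JP)// mul0e.
rewrite big_cons -ih -(il_D JP)//; last exact: nnmfun_sum.
by congr J; apply/funext => x; rewrite big_cons.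
Qed.

(** The functions n 1_B increase to a function that is +oo on [B] and 0 elsewhere, yet [J] gives 0
    to each of them and so to the limit. Adding this limit to [h] makes the comparison hold
    everywhere. *)
Lemma il_le_null (B : set T) (g h : T -> \bar R) : measurable B ->
  J (EFin \o \1_B) = 0 -> nnmfun g -> nnmfun h ->
  (forall x, ~ B x -> g x <= h x) -> J g <= J h.
Proof.
move=> mB JB gP hP gh.
pose f_ n (x : T) := n%:R%:E * (EFin \o \1_B) x : \bar R.
have f_P n : nnmfun (f_ n) by apply: nnmfunZ => //; exact: nnmfun_indic.
have nd x : nondecreasing_seq (f_ ^~ x).
  by move=> m n mn; apply: lee_wpmul2r; rewrite lee_fin// ler_nat.
have Jlim : J (fun x => limn (f_ ^~ x)) = 0.
  rewrite (il_lim JP)// (_ : (fun _ => _) = cst 0); last first.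
    apply/funext => n; rewrite (il_Z JP)//; last exact: nnmfun_indic.
    by rewrite JB mule0.
  exact: lim_cst.
rewrite -[leRHS]adde0 -Jlim -(il_D JP)//; last exact: nnmfun_lim.
apply: (il_le JP) => // [|x]; first by apply: nnmfunD => //; exact: nnmfun_lim.
have [Bx|Bx] := pselect (B x).
  have limx : limn (f_ ^~ x) = +oo.
    apply/cvg_lim => //; rewrite /f_ /=.
    under eq_fun do rewrite indicE mem_set// mule1.
    by apply/cvgeryP; exact: cvgr_idn.
  rewrite /= limx addey ?leey//.
  by case: hP => h0 _; rewrite gt_eqF// (lt_le_trans _ (h0 x)).
rewrite (le_trans (gh _ Bx))// leeDl//.
by case: (nnmfun_lim _ f_P nd) => + _; exact.
Qed.

End integral_like_theory.

(** * Two-sided approximation and periodicity *)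

Section approximation.
Context {d} {T : measurableType d} {R : realType}.
Implicit Types (g h e f : T -> \bar R) (D : set T).

(** The estimate |g - h| <= e on [D], in a form that is meaningful for infinite values. *)
Definition approx D g h e :=
  forall x, D x -> g x <= h x + e x /\ h x <= g x + e x.

Lemma approx_trans D g h f e1 e2 :
  (forall x, 0 <= e1 x) -> (forall x, 0 <= e2 x) ->
  approx D g h e1 -> approx D h f e2 ->
  approx D g f (e1 \+ e2).
Proof.
move=> e10 e20 gh hf x Dx; have [gh1 gh2] := gh x Dx; have [hf1 hf2] := hf x Dx.
split => /=.
  by rewrite (le_trans gh1)// (addeC (e1 x)) addeA leeD2r.
by rewrite (le_trans hf2)// addeA leeD2r.
Qed.

Lemma approx_le D g h1 h2 e1 e2 : (forall x, D x -> h1 x = h2 x) ->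
  (forall x, D x -> e1 x <= e2 x) ->
  approx D g h1 e1 -> approx D g h2 e2.
Proof.
move=> h12 e12 gh x Dx; have [gh1 gh2] := gh x Dx; rewrite -h12//.
by split; [apply: (le_trans gh1)|apply: (le_trans gh2)]; rewrite leeD2l// e12.
Qed.

Lemma approx_mul D g h e f : nnmfun g -> nnmfun h -> nnmfun e ->
  (forall x, 0 <= f x <= 1) ->
  approx D g h e -> approx D (f \* g) (f \* h) e.
Proof.
move=> [g0 _] [h0 _] [e0 _] f01 gh x Dx; have [gh1 gh2] := gh x Dx.
have /andP[f0 f1] := f01 x.
have fe : f x * e x <= e x by rewrite -[leRHS]mul1e; exact: lee_wpmul2r.
split => /=.
  apply: (@le_trans _ _ (f x * (h x + e x))); first exact: lee_wpmul2l.
  by rewrite ge0_muleDr// leeD2l.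
apply: (@le_trans _ _ (f x * (g x + e x))); first exact: lee_wpmul2l.
by rewrite ge0_muleDr// leeD2l.
Qed.

Lemma approxZ D (c : R) g h e : (0 <= c)%R ->
  nnmfun g -> nnmfun h -> nnmfun e -> approx D g h e ->
  approx D (fun x => c%:E * g x) (fun x => c%:E * h x) (fun x => c%:E * e x).
Proof.
move=> c0 [g0 _] [h0 _] [e0 _] gh x Dx; have [gh1 gh2] := gh x Dx.
by rewrite -!ge0_muleDr//; split; apply: lee_wpmul2l; rewrite ?lee_fin.
Qed.

Lemma approx_integral (m : {measure set T -> \bar R}) D g h e :
  measurable D -> nnmfun g -> nnmfun h -> nnmfun e -> approx D g h e ->
  \int[m]_(x in D) g x <= \int[m]_(x in D) h x + \int[m]_(x in D) e x /\
  \int[m]_(x in D) h x <= \int[m]_(x in D) g x + \int[m]_(x in D) e x.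
Proof.
move=> mD [g0 mg] [h0 mh] [e0 me] gh.
have mg' := measurable_funTS (D := D) mg.
have mh' := measurable_funTS (D := D) mh.
have me' := measurable_funTS (D := D) me.
rewrite -!ge0_integralD//; split; apply: ge0_le_integral => //.
- exact: emeasurable_funD.
- by move=> x /gh[].
- exact: emeasurable_funD.
- by move=> x /gh[].
Qed.

End approximation.

(** * The killed semigroup along the cyclic classes *)

Section periodic_chain.
Context {dE dO : measure_display} {E : measurableType dE}
  {Omega : measurableType dO} {R : realType}.
Context (X : nat -> Omega -> option E) (P : R.-pker (option E) ~> Omega).
Context (t : nat) (A : nat -> set E).
Hypothesis XP : absorbed_markov_chain X P.
Hypothesis AP : periodicity X P t A.
Local Notation S := (semigroup X P).

Let t0 : (0 < t)%N := period_gt0 AP.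
Let mA i : (i < t)%N -> measurable (A i) := class_measurable AP (i := i).

Lemma classP x : exists2 i, (i < t)%N & A i x.
Proof.
by have : setT x by []; rewrite -(class_cover AP) => -[i it Ax]; exists i.
Qed.

(** One step from [A i] charges only the next class, so the complement of that class is a null set
    for [S 1] at [x]. *)
Lemma semigroup1_le_class i x g h : (i < t)%N -> A i x -> nnmfun g -> nnmfun h ->
  (forall y, A (i.+1 %% t)%N y -> g y <= h y) -> S 1 g x <= S 1 h x.
Proof.
move=> it Ax gP hP gh; set j := (i.+1 %% t)%N in gh.
have jt : (j < t)%N by rewrite ltn_mod.
apply: (il_le_null _ (semigroup_integral_like X P XP 1 x) (~` A j)) => //.
- exact: measurableC (mA _ jt).
- have JP := semigroup_integral_like X P XP 1 x.
  apply/eqP; rewrite eq_le (il_ge0 JP) ?andbT; last first.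
    by apply: nnmfun_indic; exact: measurableC (mA _ jt).
  (* Since the classes cover E, the complement of [A j] is dominated by the sum of the indicators of
     the other classes, each of value 0 by [class_next]. *)
  pose h_ (k : 'I_t) := EFin \o \1_(A k) : E -> \bar R.
  pose s := [seq k : 'I_t <- index_enum 'I_t | (k : nat) != j].
  have hP_ k : nnmfun (h_ k) by apply: nnmfun_indic; exact: mA.
  apply: (@le_trans _ _ (S 1 (fun y => \sum_(k <- s) h_ k y) x)).
    apply: (il_le JP) => [||y].
    + by apply: nnmfun_indic; exact: measurableC (mA _ jt).
    + exact: nnmfun_sum.
    + rewrite /= indicE; case: (boolP (y \in _)) => [|_]; last first.
        by apply: sume_ge0 => k _; case: (hP_ k).
      rewrite inE /= => nAy; have [k kt Ay] := classP y.
      rewrite big_filter (bigD1 (Ordinal kt))/=; last first.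
        by apply/eqP => kj; apply: nAy; rewrite -kj.
      rewrite {1}/h_ /= indicE mem_set// leeDl//.
      by apply: sume_ge0 => k' _; case: (hP_ k').
  rewrite (il_sum _ JP)// big_filter big1// => k kj.
  by rewrite (class_next AP _ (ltn_ord k) Ax)// (negbTE kj).
- by move=> y /contrapT; exact: gh.
Qed.

Lemma semigroup_le_class n i x g h : (i < t)%N -> A i x ->
  nnmfun g -> nnmfun h ->
  (forall y, A ((i + n) %% t)%N y -> g y <= h y) -> S n g x <= S n h x.
Proof.
elim: n i x => [|n ih] i x it Ax gP hP gh.
  by rewrite !semigroup0//; apply: gh; rewrite addn0 modn_small.
rewrite -add1n !semigroup_add//.
apply: (semigroup1_le_class i) => //; try exact: nnmfun_semigroup.
move=> y Ay; apply: (ih (i.+1 %% t)%N) => //; first by rewrite ltn_mod.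
by move=> z Az; apply: gh; rewrite -[X in A X](_ : (i.+1 %% t + n) %% t = _)%N//
  modnDml addSnnS.
Qed.

Lemma semigroupZ n (c : R) g x : (0 <= c)%R -> nnmfun g ->
  S n (fun y => c%:E * g y) x = c%:E * S n g x.
Proof. exact: (il_Z (semigroup_integral_like X P XP n x)). Qed.

(** From [A i], n steps lead to [A j], so an estimate known on [A j] alone can be pulled back to
    [A i]. *)
Lemma approx_semigroup n i j g h e : (i < t)%N -> j = ((i + n) %% t)%N ->
  nnmfun g -> nnmfun h -> nnmfun e -> approx (A j) g h e ->
  approx (A i) (S n g) (S n h) (S n e).
Proof.
move=> it -> gP hP eP gh x Ax.
have JD := il_D (semigroup_integral_like X P XP n x).
by split; rewrite -JD//; apply: (semigroup_le_class _ i) => //;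
  [exact: nnmfunD|move=> y /gh[]|exact: nnmfunD|move=> y /gh[]].
Qed.

End periodic_chain.

Lemma semigroup_le1 {dE dO : measure_display} {E : measurableType dE}
    {Omega : measurableType dO} {R : realType} (X : nat -> Omega -> option E)
    (P : R.-pker (option E) ~> Omega) n x : absorbed_markov_chain X P ->
  semigroup X P n (cst 1) x <= 1.
Proof.
move=> XP; rewrite -prob_alive//.
rewrite -[leRHS](prob_kernel (Some x) (s := P)); apply: le_measure; rewrite ?inE//.
exact: (measurable_alive X P XP).
Qed.

(** * Consequences of assumption (H) *)

Section geometric.
Context {dE dO : measure_display} {E : measurableType dE}
  {Omega : measurableType dO} {R : realType}.
Context (X : nat -> Omega -> option E) (P : R.-pker (option E) ~> Omega).
Context (t : nat) (A : nat -> set E).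
Context (V eta : E -> R) (theta0 CQ alpha : R) (nu : probability E R).
Hypothesis XP : absorbed_markov_chain X P.
Hypothesis AP : periodicity X P t A.
Hypothesis HP : assumptionH X P t A V eta theta0 CQ alpha nu.
Local Notation S := (semigroup X P).
Local Notation "r *e u" := (fun x => r%:E * (u x)%:E) (at level 40).

Let t0 : (0 < t)%N := period_gt0 AP.
Let mA i : (i < t)%N -> measurable (A i) := class_measurable AP (i := i).
Let th0 : (0 < theta0)%R := theta0_gt0 HP.
Let th1 : (theta0 <= 1)%R := theta0_le1 HP.
Let thk0 k : (0 < theta0 ^+ k)%R := exprn_gt0 k th0.
Let CQ0 : (0 <= CQ)%R := CQ_ge0 HP.
Let al0 k : (0 <= alpha ^+ k)%R := exprn_ge0 k (ltW (alpha_gt0 HP)).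

Lemma V_ge0 x : (0 <= V x)%R.
Proof.
have [Ax|Ax] := pselect (A 0%N x); last by rewrite (V_off HP).
exact: le_trans ler01 (V_ge1 HP Ax).
Qed.

Lemma nnmfun_V : nnmfun (EFin \o V).
Proof.
split; first by move=> x; rewrite lee_fin V_ge0.
exact/measurable_EFinP/(V_measurable HP).
Qed.

Lemma nnmfun_eta : nnmfun (EFin \o eta).
Proof.
split; first by move=> x; rewrite lee_fin (eta_ge0 HP).
exact/measurable_EFinP/(eta_measurable HP).
Qed.

Lemma nu_integral_like : integral_like (fun g => \int[nu]_x g x).
Proof. exact: (integral_like_comp1 nu setT id). Qed.

Lemma nu_le_class g h : nnmfun g -> nnmfun h ->
  (forall x, A 0%N x -> g x <= h x) -> \int[nu]_x g x <= \int[nu]_x h x.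
Proof.
move=> gP hP gh; have mcA : measurable (~` A 0%N) by apply: measurableC; exact: mA.
apply: (il_le_null _ nu_integral_like (~` A 0%N)) => //.
  by rewrite integral_indic// setIT; exact: (nu_off HP).
by move=> x /contrapT; exact: gh.
Qed.

Definition nuV : R := fine (\int[nu]_x (V x)%:E).

Lemma nuVE : \int[nu]_x (V x)%:E = nuV%:E.
Proof.
rewrite /nuV fineK// ge0_fin_numE; first exact: (nu_V HP).
by apply: integral_ge0 => x _; rewrite lee_fin V_ge0.
Qed.

Lemma nuV_ge0 : (0 <= nuV)%R.
Proof.
by rewrite -lee_fin -nuVE; apply: integral_ge0 => x _; rewrite lee_fin V_ge0.
Qed.

Lemma nu_fin (a : R) g : (0 <= a)%R -> nnmfun g ->
  (forall y, A 0%N y -> g y <= (a * V y)%:E) ->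
  \int[nu]_x g x = (fine (\int[nu]_x g x))%:E /\
  (0 <= fine (\int[nu]_x g x) <= a * nuV)%R.
Proof.
move=> a0 gP gV.
have ng0 : 0 <= \int[nu]_x g x by apply: integral_ge0 => x _; case: gP.
have ngV : \int[nu]_x g x <= (a * nuV)%:E.
  rewrite EFinM -nuVE -(il_Z nu_integral_like _ _ a0 nnmfun_V).
  apply: nu_le_class => //; exact: (nnmfunZ _ _ a0 nnmfun_V).
have nfin : \int[nu]_x g x \is a fin_num.
  by rewrite ge0_fin_numE// (le_lt_trans ngV)// ltry.
rewrite fineK//; split => //.
by rewrite -!lee_fin fineK// ng0.
Qed.

(* Assumption (H) rewritten without subtraction, for possibly infinite g. *)
Lemma geometric_approx (a : R) g k : (0 < a)%R -> nnmfun g ->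
  (forall y, A 0%N y -> g y <= (a * V y)%:E) ->
  approx (A 0%N) (S (k * t) g)
    ((theta0 ^+ (k * t) * fine (\int[nu]_x g x)) *e eta)
    ((theta0 ^+ (k * t) * (a * CQ * alpha ^+ k)) *e V).
Proof.
move=> a0 gP gV x Ax; set p := fine _.
have [nuE _] := nu_fin _ _ (ltW a0) gP gV.
(* A real-valued test function for (H): [g] is cut off outside [A 0], where [V] vanishes, and
   divided by [a] so that |f| <= V. *)
pose f y := (fine (g y) * \1_(A 0%N) y / a)%R.
have mf : measurable_fun setT f.
  apply: measurable_funM => //; apply: measurable_funM.
    by case: gP => _ mg; exact: measurableT_comp.
  by apply: measurable_indic; exact: mA.
have gfin y : A 0%N y -> g y = (fine (g y))%:E.
  move=> Ay; rewrite fineK// ge0_fin_numE; last by case: gP.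
  by rewrite (le_lt_trans (gV y Ay))// ltry.
have f0 y : (0 <= f y)%R.
  rewrite /f divr_ge0// ?(ltW a0)// mulr_ge0// fine_ge0//.
  by case: gP.
have fV y : (`|f y| <= V y)%R.
  rewrite ger0_norm// /f indicE.
  have [Ay|Ay] := pselect (A 0%N y); last by rewrite memNset// mulr0 mul0r V_ge0.
  rewrite mem_set// mulr1 ler_pdivrMr// mulrC -lee_fin -gfin//.
  exact: gV.
have fP : nnmfun (EFin \o f).
  by split; [move=> y; rewrite lee_fin|exact/measurable_EFinP].
have af y : A 0%N y -> a%:E * (EFin \o f) y = g y.
  move=> Ay; rewrite /= -EFinM /f indicE mem_set// mulr1 mulrC divfK ?gt_eqF//.
  by rewrite -gfin.
have afP := nnmfunZ _ _ (ltW a0) fP.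
(* [g] and a f agree on [A 0], to which the chain returns after k t steps. *)
have Sg : S (k * t) g x = a%:E * S (k * t) (EFin \o f) x.
  rewrite -semigroupZ// ?(ltW a0)//.
  by apply/eqP; rewrite eq_le; apply/andP; split;
    apply: (semigroup_le_class _ _ _ _ XP AP _ 0%N) => // y;
    rewrite add0n modnMl => Ay; rewrite af.
have ng : \int[nu]_x g x = a%:E * \int[nu]_y (f y)%:E.
  rewrite -[RHS](il_Z nu_integral_like _ _ (ltW a0) fP).
  by apply/eqP; rewrite eq_le; apply/andP; split;
    apply: nu_le_class => // y Ay; rewrite af.
have := geometric_convergence HP k mf fV Ax.
have f1V y : A 0%N y -> (EFin \o f) y <= (1 * V y)%:E.
  by move=> _; rewrite lee_fin mul1r (le_trans (ler_norm _)).
have [nfE _] := nu_fin _ _ ler01 fP f1V.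
move: Sg ng; rewrite nuE -/p.
set q := fine _ in nfE *; rewrite nfE.
have Sf0 : 0 <= S (k * t) (EFin \o f) x.
  exact: (il_ge0 (semigroup_integral_like X P XP _ x)).
have ti0 : (0 < theta0 ^- (k * t))%R by rewrite invr_gt0.
(* An infinite value is excluded by (H) itself, whose left side would be infinite. *)
case: (S _ (EFin \o f) x) Sf0 => [s _|_|//]; last first.
  by move=> _ _; rewrite gt0_muley ?lte_fin// -EFinM /= leye_eq.
move=> -> [->]; rewrite -!EFinM -!EFinD/= !lee_fin => /ler_normlP[h1 h2].
pose u := (theta0 ^- (k * t) * s)%R.
have sE : s = (theta0 ^+ (k * t) * u)%R by rewrite /u mulrA divff ?gt_eqF// mul1r.
rewrite -/u in h1 h2; rewrite sE.
have aT : (0 <= a * theta0 ^+ (k * t))%R by rewrite mulr_ge0 ?ltW.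
have l1 := ler_wpM2l aT h1; have l2 := ler_wpM2l aT h2.
split; nra.
Qed.

Lemma eta_le_V : exists M : R, (0 < M)%R /\ forall x, (eta x <= M * V x)%R.
Proof.
have [M HM] := eta_V_bounded HP; exists (Num.max M 1%R); split => [|x].
  by rewrite lt_max ltr01 orbT.
have [Ax|Ax] := pselect (A 0%N x); last by rewrite (eta_off HP)// (V_off HP)// mulr0.
have V0 : (0 < V x)%R by rewrite (lt_le_trans ltr01)// (V_ge1 HP).
by rewrite -ler_pdivrMr// le_max HM.
Qed.

Section constants.
Variable M : R.
Hypotheses (M0 : (0 < M)%R) (etaM : forall x, (eta x <= M * V x)%R).

(** Bounds theta0^{-kt} P_{kt} V by a multiple of [V] on [A 0]: [nuV * M] comes from the main term
    of (H), [CQ] from its error, and the summand 1 makes the constant positive. *)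
Definition growth : R := (nuV * M + CQ + 1)%R.

Lemma growth_gt0 : (0 < growth)%R.
Proof.
by rewrite /growth ltr_wpDl// addr_ge0// mulr_ge0 ?nuV_ge0// ltW.
Qed.

Lemma V_growth k x : A 0%N x ->
  S (k * t) (EFin \o V) x <= (theta0 ^+ (k * t) * (growth * V x))%:E.
Proof.
move=> Ax; have Vle y : A 0%N y -> (EFin \o V) y <= (1 * V y)%:E.
  by rewrite mul1r.
have [h _] := geometric_approx _ _ k ltr01 nnmfun_V Vle x Ax.
rewrite (le_trans h)// /= -!EFinM -EFinD lee_fin -[fine _]/nuV.
rewrite -!mulrA -mulrDr; apply: ler_wpM2l; first exact: ltW.
have h1 : (nuV * eta x <= nuV * (M * V x))%R by rewrite ler_wpM2l ?nuV_ge0.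
have h2 : (CQ * (alpha ^+ k * V x) <= CQ * V x)%R.
  rewrite ler_wpM2l// ler_piMl ?V_ge0//.
  by rewrite exprn_ile1// ltW// ?(alpha_gt0 HP) ?(alpha_lt1 HP).
have := V_ge0 x; rewrite /growth; lra.
Qed.

Let one_le_V y : A 0%N y -> cst 1 y <= (1 * V y)%:E :> \bar R.
Proof. by move=> Ay; rewrite mul1r lee_fin (V_ge1 HP). Qed.

Let Sadd m n g : nnmfun g -> S (m + n) g = S m (S n g).
Proof. exact: semigroup_add. Qed.

Definition survival_mass r : R := fine (\int[nu]_x S r (cst 1) x).
Local Notation p := survival_mass.

Let S1_le_V r y : A 0%N y -> S r (cst 1) y <= (1 * V y)%:E.
Proof.
by move=> Ay; rewrite (le_trans (semigroup_le1 _ _ _ _ XP))// one_le_V.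
Qed.

Let nnmfun1 : nnmfun (cst 1 : E -> \bar R).
Proof. by split. Qed.

Let nnmfun_S n g : nnmfun g -> nnmfun (S n g).
Proof. exact: nnmfun_semigroup. Qed.

Lemma survival_massE r : \int[nu]_x S r (cst 1) x = (p r)%:E.
Proof.
by have [] := nu_fin _ _ ler01 (nnmfun_S r _ nnmfun1) (S1_le_V r).
Qed.

Lemma survival_mass_ge0 r : (0 <= p r)%R.
Proof.
have [_ /andP[]] := nu_fin _ _ ler01 (nnmfun_S r _ nnmfun1) (S1_le_V r).
by [].
Qed.

Lemma survival_mass_le1 r : (p r <= 1)%R.
Proof.
rewrite -lee_fin -survival_massE -[leRHS](probability_setT nu) -[leRHS]mul1e.
rewrite -integral_cst//; apply: (il_le nu_integral_like) => //.
  exact: nnmfun_S.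
by move=> x; exact: semigroup_le1.
Qed.

Lemma survival_approx k r : approx (A 0%N) (S (k * t) (S r (cst 1)))
  ((theta0 ^+ (k * t) * p r) *e eta) ((theta0 ^+ (k * t) * (CQ * alpha ^+ k)) *e V).
Proof.
have := geometric_approx _ _ k ltr01 (nnmfun_S r _ nnmfun1) (S1_le_V r).
by rewrite mul1r.
Qed.

(** * Estimates from an initial law restricted to one class *)

Section initial_class.
Variables (mu : probability E R) (i : nat).
Hypotheses (it : (i < t)%N)
  (Vfin : \int[mu]_(x in A i) S (t - i) (EFin \o V) x < +oo).

Definition class_V : R := fine (\int[mu]_(x in A i) S (t - i) (EFin \o V) x).
Definition class_eta : R := fine (\int[mu]_(x in A i) S (t - i) (EFin \o eta) x).

Let class_ge0 g : nnmfun g -> 0 <= \int[mu]_(x in A i) g x.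
Proof. by move=> gP; apply: integral_ge0 => x _; case: gP. Qed.

Lemma class_VE :
  \int[mu]_(x in A i) S (t - i) (EFin \o V) x = class_V%:E /\ (0 <= class_V)%R.
Proof.
have h := class_ge0 _ (nnmfun_S (t - i) _ nnmfun_V).
by rewrite /class_V fineK ?fine_ge0// ge0_fin_numE.
Qed.

Let class_integral_like n : integral_like (fun g => \int[mu]_(x in A i) S n g x).
Proof.
apply: (integral_like_nested mu (A i) (mA _ it) (fun x g => S n g x)).
  by move=> x _; exact: semigroup_integral_like.
by move=> g gP; apply: measurable_funTS; case: (nnmfun_S n _ gP).
Qed.

Lemma class_etaE : \int[mu]_(x in A i) S (t - i) (EFin \o eta) x = class_eta%:E /\
  (0 <= class_eta <= M * class_V)%R.
Proof.
have h0 := class_ge0 _ (nnmfun_S (t - i) _ nnmfun_eta).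
have h : \int[mu]_(x in A i) S (t - i) (EFin \o eta) x <= (M * class_V)%:E.
  rewrite EFinM -class_VE.1 -(il_Z (class_integral_like _) _ _ (ltW M0) nnmfun_V).
  apply: (il_le (class_integral_like _)); first exact: nnmfun_eta.
    exact: (nnmfunZ _ _ (ltW M0) nnmfun_V).
  by move=> x; rewrite lee_fin.
have hfin : \int[mu]_(x in A i) S (t - i) (EFin \o eta) x \is a fin_num.
  by rewrite (ge0_fin_numE h0) (le_lt_trans h (ltry _)).
rewrite /class_eta fineK//; split => //.
by rewrite fine_ge0//= -lee_fin fineK.
Qed.

(** The passage from functions to real numbers: an estimate on [A 0] is pulled back to [A i] by
    P_{t-i} and integrated against [mu]. Finiteness of [class_V] makes the result finite. *)
Lemma class_approx g (c e : R) : nnmfun g -> (0 <= c)%R -> (0 <= e)%R ->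
  approx (A 0%N) g (c *e eta) (e *e V) ->
  let y := \int[mu]_(x in A i) S (t - i) g x in
  [/\ y = (fine y)%:E, (0 <= fine y)%R &
      (`|fine y - c * class_eta| <= e * class_V)%R].
Proof.
move=> gP c0 e0 gapp y.
have y0 : 0 <= y by exact: class_ge0 _ (nnmfun_S (t - i) _ gP).
have mod0 : 0%N = ((i + (t - i)) %% t)%N by rewrite subnKC ?modnn// ltnW.
have ceP := nnmfunZ _ _ c0 nnmfun_eta.
have eVP := nnmfunZ _ _ e0 nnmfun_V.
have h := approx_semigroup _ _ _ _ XP AP _ _ _ _ _ _ it mod0 gP ceP eVP gapp.
have := approx_integral mu _ _ _ _ (mA _ it) (nnmfun_S _ _ gP)
  (nnmfun_S _ _ ceP) (nnmfun_S _ _ eVP) h.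
rewrite (il_Z (class_integral_like _) _ _ c0 nnmfun_eta).
rewrite (il_Z (class_integral_like _) _ _ e0 nnmfun_V).
rewrite class_VE.1 class_etaE.1 -!EFinM -/y => -[h1 h2].
have yfin : y \is a fin_num by rewrite (ge0_fin_numE y0) (le_lt_trans h1 (ltry _)).
move: h1 h2; rewrite (fine_ge0 y0) -(fineK yfin) -!EFinD !lee_fin => h1 h2.
by split => //; rewrite ler_norml; apply/andP; split; lra.
Qed.

Lemma class_survival k r : 
  let y := \int[mu]_(x in A i) S (t - i + (k * t + r)) (cst 1) x in
  [/\ y = (fine y)%:E, (0 <= fine y)%R &
      (`|fine y - theta0 ^+ (k * t) * p r * class_eta| <=
       theta0 ^+ (k * t) * (CQ * alpha ^+ k) * class_V)%R].
Proof.
have -> : S (t - i + (k * t + r)) (cst 1) = S (t - i) (S (k * t) (S r (cst 1))).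
  by rewrite (Sadd _ _ _ nnmfun1) (Sadd (k * t)%N r _ nnmfun1).
apply: class_approx.
- exact/nnmfun_S/nnmfun_S.
- by rewrite mulr_ge0 ?survival_mass_ge0// ltW.
- by rewrite !mulr_ge0// ltW.
- exact: survival_approx.
Qed.

End initial_class.

(** * Observables with values in [0,1] seen at an intermediate time *)

Section observable.
Variable f : E -> \bar R.
Hypotheses (mf : measurable_fun setT f) (f01 : forall x, 0 <= f x <= 1).

Let fP : nnmfun f.
Proof. by split => // x; case/andP: (f01 x). Qed.

Lemma nnmfun_fM g : nnmfun g -> nnmfun (f \* g).
Proof. exact: nnmfunM. Qed.

(** A full cycle ending in [eta], with [f] inserted after [l] steps; its nu-integral is the l-th
    term of the limit. *)
Definition weighted_eta l := S l (f \* S (t - l) (EFin \o eta)).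

Lemma nnmfun_weighted_eta l : nnmfun (weighted_eta l).
Proof. exact/nnmfun_S/nnmfun_fM/nnmfun_S/nnmfun_eta. Qed.

Lemma semigroup_fM_le n l g x : nnmfun g ->
  S n (f \* S l g) x <= S (n + l) g x.
Proof.
move=> gP; rewrite semigroup_add//.
apply: (il_le (semigroup_integral_like X P XP n x)).
- exact/nnmfun_fM/nnmfun_S.
- exact: nnmfun_S.
- move=> y /=; rewrite -[leRHS]mul1e lee_wpmul2r//.
    by have [] := nnmfun_S l _ gP.
  by case/andP: (f01 y).
Qed.

Lemma semigroup_t_eta_le x : A 0%N x ->
  S t (EFin \o eta) x <= (M * growth * V x)%:E.
Proof.
move=> Ax; apply: (@le_trans _ _ (M%:E * S t (EFin \o V) x)).
  rewrite -semigroupZ//; [|exact: ltW|exact: nnmfun_V].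
  apply: (il_le (semigroup_integral_like X P XP t x)).
  - exact: nnmfun_eta.
  - exact: (nnmfunZ _ _ (ltW M0) nnmfun_V).
  - by move=> y /=; rewrite lee_fin.
rewrite -mulrA EFinM; apply: lee_wpmul2l; first by rewrite lee_fin ltW.
have := V_growth 1 _ Ax; rewrite mul1n => /le_trans; apply.
rewrite lee_fin ler_piMl// ?exprn_ile1// ?(ltW th0)//.
by rewrite mulr_ge0 ?V_ge0// ltW// growth_gt0.
Qed.

Lemma weighted_eta_le l x : (l <= t)%N -> A 0%N x ->
  weighted_eta l x <= (M * growth * V x)%:E.
Proof.
move=> lt Ax; rewrite (le_trans (semigroup_fM_le _ _ _ _ nnmfun_eta))//.
by rewrite subnKC// semigroup_t_eta_le.
Qed.

Definition weight l : R := fine (\int[nu]_x weighted_eta l x).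

Let MK0 : (0 < M * growth)%R.
Proof. by rewrite mulr_gt0// growth_gt0. Qed.

Lemma weightE l : (l <= t)%N ->
  \int[nu]_x weighted_eta l x = (weight l)%:E /\
  (0 <= weight l <= M * growth * nuV)%R.
Proof.
move=> lt; apply: nu_fin; first exact: ltW.
  exact: nnmfun_weighted_eta.
by move=> y; exact: weighted_eta_le.
Qed.

(** The first summand is the error of (H) on the [n] late cycles, carried through the split cycle
    and the [j] early ones, each time at the cost of a factor [growth]. The second is the error of
    (H) on the early cycles, for a function bounded by M growth V. *)
Definition cycle_const : R := (growth * growth * CQ + M * growth * CQ)%R.

(** (H) is used twice, before and after the cycle in which [f] is read. That cycle yields the factor
    [weight l] and no power of theta0, which is why the exponent counts only j + n cycles. *)
Lemma cycle_approx j n l r : (l < t)%N ->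
  approx (A 0%N) (S (j * t) (S l (f \* S (t - l) (S (n * t) (S r (cst 1))))))
    ((theta0 ^+ ((j + n) * t) * (p r * weight l)) *e eta)
    ((theta0 ^+ ((j + n) * t) * (cycle_const * (alpha ^+ j + alpha ^+ n))) *e V).
Proof.
move=> lt.
have nneP c : (0 <= c)%R -> nnmfun (c *e eta).
  by move=> c0; exact: (nnmfunZ _ _ c0 nnmfun_eta).
have nnVP c : (0 <= c)%R -> nnmfun (c *e V).
  by move=> c0; exact: (nnmfunZ _ _ c0 nnmfun_V).
have c1 : (0 <= theta0 ^+ (n * t) * p r)%R.
  by rewrite mulr_ge0 ?survival_mass_ge0// ltW.
have c2 : (0 <= theta0 ^+ (n * t) * (CQ * alpha ^+ n))%R.
  by rewrite !mulr_ge0// ltW.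
have nnS1 : nnmfun (S (n * t) (S r (cst 1))) by exact/nnmfun_S/nnmfun_S.
have c2K : (0 <= theta0 ^+ (n * t) * (CQ * alpha ^+ n) * growth)%R.
  by rewrite mulr_ge0// ltW// growth_gt0.
have lmod : 0%N = ((l + (t - l)) %% t)%N by rewrite subnKC ?modnn// ltnW.
have jmod : 0%N = ((0 + j * t) %% t)%N by rewrite add0n modnMl.
(* First use of (H): P_{nt} P_r 1 is replaced by its multiple of [eta], and the estimate is carried
   back through P_{t-l}, the factor [f] and P_l. *)
have h1 := approx_semigroup _ _ _ _ XP AP (t - l) l 0%N _ _ _ lt lmod
  nnS1 (nneP _ c1) (nnVP _ c2) (survival_approx n r).
have {}h1 := approx_mul _ _ _ _ _ (nnmfun_S _ _ nnS1) (nnmfun_S _ _ (nneP _ c1))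
  (nnmfun_S _ _ (nnVP _ c2)) f01 h1.
have {}h1 := approx_semigroup _ _ _ _ XP AP l 0%N l _ _ _ t0
  (esym (modn_small lt)) (nnmfun_fM _ (nnmfun_S _ _ nnS1))
  (nnmfun_fM _ (nnmfun_S _ _ (nneP _ c1))) (nnmfun_S _ _ (nnVP _ c2)) h1.
(* The two side conditions, on the main term and on the error, stay open here; [E1] and [E2] supply
   them. *)
have {}h1 := approx_le _ _ _ (fun x => (theta0 ^+ (n * t) * p r)%:E * weighted_eta l x) _
  ((theta0 ^+ (n * t) * (CQ * alpha ^+ n) * growth) *e V) _ _ h1.
have SZ m c g x : (0 <= c)%R -> nnmfun g ->
  S m (fun y => c%:E * g y) x = c%:E * S m g x by move=> ? ?; exact: semigroupZ.
have Seta m c : (0 <= c)%R -> S m (c *e eta) = fun x => c%:E * S m (EFin \o eta) x.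
  by move=> c0; apply/funext => x; exact: (SZ _ _ _ _ c0 nnmfun_eta).
have SV m c : (0 <= c)%R -> S m (c *e V) = fun x => c%:E * S m (EFin \o V) x.
  by move=> c0; apply/funext => x; exact: (SZ _ _ _ _ c0 nnmfun_V).
have /andP[w0 _] := (weightE _ (ltnW lt)).2.
have {}h1 := approx_semigroup _ _ _ _ XP AP (j * t) 0%N 0%N _ _ _ t0 jmod
  _ (nnmfunZ _ _ c1 (nnmfun_weighted_eta l)) (nnVP _ c2K) (h1 _ _).
(* Second use of (H), on the early stretch P_{jt} applied to [weighted_eta l]. *)
have h2 := geometric_approx _ _ j MK0 (nnmfun_weighted_eta l)
  (fun y => weighted_eta_le _ y (ltnW lt)).
have {}h2 := approxZ _ _ _ _ _ c1 (nnmfun_S _ _ (nnmfun_weighted_eta l)) (nneP _ _)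
  (nnVP _ _) h2.
have jt0 : (0 <= theta0 ^+ (j * t))%R by exact: ltW.
have e0 : (0 <= theta0 ^+ (j * t) * (M * growth * CQ * alpha ^+ j))%R.
  by rewrite mulr_ge0// mulr_ge0// mulr_ge0// ltW.
have {}h2 := h2 (mulr_ge0 jt0 w0) e0.
have E1 x : A 0%N x ->
    S l (f \* S (t - l) ((theta0 ^+ (n * t) * p r) *e eta)) x =
    (theta0 ^+ (n * t) * p r)%:E * weighted_eta l x.
  move=> _; rewrite -SZ//; last exact/nnmfun_fM/nnmfun_S/nnmfun_eta.
  congr (S l _ x); apply/funext => y /=.
  by rewrite Seta// muleCA.
(* P_l P_{t-l} is one full cycle, so [V_growth] with k = 1 applies; its factor theta0^t <= 1 is
   dropped. *)
have E2 x : A 0%N x ->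
    S l (S (t - l) ((theta0 ^+ (n * t) * (CQ * alpha ^+ n)) *e V)) x <=
    (theta0 ^+ (n * t) * (CQ * alpha ^+ n) * growth)%:E * (V x)%:E.
  move=> Ax; rewrite -semigroup_add//; last exact: nnVP.
  rewrite subnKC ?(ltnW lt)// SV//.
  rewrite [X in _ <= X * _]EFinM -muleA; apply: lee_wpmul2l => //.
  have := V_growth 1 _ Ax; rewrite mul1n => /le_trans; apply.
  rewrite -EFinM lee_fin ler_piMl// ?exprn_ile1// ?(ltW th0)//.
  by rewrite mulr_ge0 ?V_ge0// ltW// growth_gt0.
have {}h1 := h1 (nnmfun_S _ _ (nnmfun_fM _ (nnmfun_S _ _ nnS1))) E1 E2.
have E3 : S (j * t) (fun x => (theta0 ^+ (n * t) * p r)%:E * weighted_eta l x) =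
    fun x => (theta0 ^+ (n * t) * p r)%:E * S (j * t) (weighted_eta l) x.
  by apply/funext => x; rewrite SZ//; exact: nnmfun_weighted_eta.
rewrite E3 in h1.
have ge1 := (nnmfun_S (j * t)%N _ (nnVP _ c2K)).1.
have ge2 := (nnmfunZ _ _ c1 (nnVP _ e0)).1.
apply: approx_le (approx_trans _ _ _ _ _ _ ge1 ge2 h1 h2) => x Ax.
  by rewrite -!EFinM -/(weight l); congr EFin; rewrite mulnDl exprD; ring.
rewrite /= SV//.
apply: (@le_trans _ _ ((theta0 ^+ (n * t) * (CQ * alpha ^+ n) * growth)%:E *
    (theta0 ^+ (j * t) * (growth * V x))%:E +
    (theta0 ^+ (n * t) * p r)%:E * ((theta0 ^+ (j * t) *
      (M * growth * CQ * alpha ^+ j))%:E * (V x)%:E))).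
  by rewrite leeD2r// lee_wpmul2l// ?lee_fin// V_growth.
rewrite -!EFinM -!EFinD lee_fin mulnDl exprD /cycle_const.
rewrite -[leRHS](_ : theta0 ^+ (n * t) * theta0 ^+ (j * t) * (growth * CQ * V x) *
  ((growth + M) * (alpha ^+ j + alpha ^+ n)) = _)%R; last by ring.
rewrite [leLHS](_ : _ =
  theta0 ^+ (n * t) * theta0 ^+ (j * t) * (growth * CQ * V x) *
  (growth * alpha ^+ n + M * (p r * alpha ^+ j)))%R; last by ring.
have g0 := ltW growth_gt0.
apply: ler_wpM2l; first by rewrite !mulr_ge0// ?V_ge0// ltW.
have pa : (p r * alpha ^+ j <= alpha ^+ j)%R by rewrite ler_piMl ?survival_mass_le1.
have := al0 j; have := al0 n => an aj.
have : (M * (p r * alpha ^+ j) <= M * alpha ^+ j)%R by rewrite ler_wpM2l// ltW.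
have := mulr_ge0 g0 aj; have := mulr_ge0 (ltW M0) an.
move: (alpha ^+ j)%R (alpha ^+ n)%R (p r * _)%R (growth) => u v w G ? ? ?.
nra.
Qed.

Lemma cycle_const_ge0 : (0 <= cycle_const)%R.
Proof. by have g0 := ltW growth_gt0; rewrite addr_ge0// !mulr_ge0// ltW. Qed.

(** The elapsed time and the remaining time add up to (t-i) + (j+n+1)t + r, because [l] and [t - l]
    together fill one cycle. *)
Lemma class_cycle (mu : probability E R) i j n l r : (i < t)%N -> (l < t)%N ->
  \int[mu]_(x in A i) S (t - i) (EFin \o V) x < +oo ->
  let y := \int[mu]_(x in A i) S (t - i + (j * t + l))
    (f \* S (t - l + (n * t + r)) (cst 1)) x in
  [/\ y = (fine y)%:E, (0 <= fine y)%R &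
      (`|fine y - theta0 ^+ ((j + n) * t) * (p r * weight l) * class_eta mu i| <=
       theta0 ^+ ((j + n) * t) * (cycle_const * (alpha ^+ j + alpha ^+ n)) *
       class_V mu i)%R].
Proof.
move=> it lt Vfin.
have S1P : nnmfun (S (t - l + (n * t + r)) (cst 1)) by exact: nnmfun_S.
have -> : S (t - i + (j * t + l)) (f \* S (t - l + (n * t + r)) (cst 1)) =
    S (t - i) (S (j * t) (S l (f \* S (t - l) (S (n * t) (S r (cst 1)))))).
  have fSP := nnmfun_fM _ S1P.
  rewrite (Sadd _ _ _ fSP) (Sadd (j * t)%N l _ fSP).
  by rewrite (Sadd (t - l)%N _ _ nnmfun1) (Sadd (n * t)%N r _ nnmfun1).
have /andP[w0 _] := (weightE _ (ltnW lt)).2.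
apply: class_approx => //.
- by apply/nnmfun_S/nnmfun_S/nnmfun_fM; do 3 apply: nnmfun_S.
- exact: mulr_ge0 (ltW (thk0 _)) (mulr_ge0 (survival_mass_ge0 r) w0).
- exact: mulr_ge0 (ltW (thk0 _)) (mulr_ge0 cycle_const_ge0 (addr_ge0 (al0 _) (al0 _))).
- exact: cycle_approx.
Qed.

End observable.
End constants.
End geometric.

(** * Real-number estimates *)

Section cycle_sums.
Variable R : realType.
Local Open Scope ring_scope.

Lemma sum_geometric_le (al : R) k : 0 < al -> al < 1 ->
  \sum_(j < k) al ^+ j <= (1 - al)^-1.
Proof.
move=> a0 a1.
have -> : (1 - al)^-1 = \sum_(j < k) al ^+ j + (1 - al)^-1 * al ^+ k.
  elim: k => [|k ih]; first by rewrite big_ord0 expr0 mulr1 add0r.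
  by rewrite big_ord_recr/= {1}ih exprS; field; rewrite subr_eq0 gt_eqF.
by rewrite lerDl mulr_ge0 ?invr_ge0 ?subr_ge0 ?exprn_ge0 ?(ltW a0) ?(ltW a1).
Qed.

(** Each of the first [k] powers is at least al^k. This turns geometric decay into decay of order
    1/k. *)
Lemma natr_expr_le (al : R) k : 0 < al -> al < 1 ->
  k%:R * al ^+ k <= (1 - al)^-1.
Proof.
move=> a0 a1; apply: le_trans (sum_geometric_le al k a0 a1).
rewrite mulr_natl -[X in _ *+ X]card_ord -sumr_const; apply: ler_sum => j _.
by rewrite ler_wiXn2l ?(ltW a0) ?(ltW a1)// ltnW.
Qed.

Lemma sum_nat_blocks (F : nat -> R) k t :
  \sum_(m < k * t) F m = \sum_(j < k) \sum_(l < t) F (j * t + l)%N.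
Proof.
elim: k => [|k ih]; first by rewrite mul0n !big_ord0.
by rewrite mulSnr big_split_ord/= ih big_ord_recr.
Qed.

Variables (theta al C M K2 Q : R) (t : nat) (q : nat -> R).
Hypotheses (th0 : 0 < theta) (th1 : theta <= 1) (al0 : 0 < al) (al1 : al < 1)
  (C0 : 0 <= C) (M0 : 0 <= M) (K20 : 0 <= K2) (t0 : (0 < t)%N)
  (q0 : forall l, (l < t)%N -> 0 <= q l <= Q).

Definition limit_mean : R := theta ^- t / t%:R * \sum_(l < t) q l.

(** The four summands pay, in order, for the times outside full cycles, for the full cycles, for
    replacing the limiting survival mass by the true one, and for the defect in
    [class_survival_lower]. The prefactor converts theta^{kt} into theta^N, as N <= (k+2)t. *)
Definition error_const : R :=
  theta ^- (2 * t) * (2 * t%:R * (1 + theta ^- t * Q) * (M + C) +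
    theta ^- t * (t%:R * K2 * (2 * (1 - al)^-1)) +
    t%:R * (theta ^- t * Q) * C * (1 - al)^-1 +
    C * t%:R * ((1 - al)^-1 + 2)).

Let tht0 : 0 < theta ^- t. Proof. by rewrite invr_gt0 exprn_gt0. Qed.
Let tR0 : 0 < t%:R :> R. Proof. by rewrite ltr0n. Qed.

Lemma limit_mean_bounds : 0 <= limit_mean <= theta ^- t * Q.
Proof.
have s0 : 0 <= \sum_(l < t) q l by apply: sumr_ge0 => l _; case/andP: (q0 l (ltn_ord l)).
have s1 : \sum_(l < t) q l <= t%:R * Q.
  rewrite -[X in X%:R]card_ord mulr_natl -sumr_const.
  by apply: ler_sum => l _; case/andP: (q0 l (ltn_ord l)).
rewrite /limit_mean; apply/andP; split; first by rewrite mulr_ge0// divr_ge0// ltW.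
by rewrite -mulrA ler_pM2l// mulrC ler_pdivrMr// mulrC.
Qed.

Lemma error_const_ge0 : 0 <= error_const.
Proof.
have tt := ltW tR0; have hh := ltW tht0.
have gg : 0 <= (1 - al)^-1 by rewrite invr_ge0 subr_ge0 ltW.
have B0 : 0 <= theta ^- t * Q.
  by have /andP[L0 LB] := limit_mean_bounds; exact: le_trans LB.
have n2 : 0 <= 2 :> R := ler0n _ 2.
rewrite mulr_ge0 ?invr_ge0 ?exprn_ge0 ?(ltW th0)// !addr_ge0//.
- exact: mulr_ge0 (mulr_ge0 (mulr_ge0 n2 tt) (addr_ge0 ler01 B0)) (addr_ge0 M0 C0).
- exact: mulr_ge0 hh (mulr_ge0 (mulr_ge0 tt K20) (mulr_ge0 n2 gg)).
- exact: mulr_ge0 (mulr_ge0 (mulr_ge0 tt B0) C0) gg.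
- exact: mulr_ge0 (mulr_ge0 C0 tt) (addr_ge0 gg n2).
Qed.

(** In the application [s] is t - i, [p] is nu(P_r 1), [a] and [b] are the integrals of P_s eta and
    P_s V over [A i], [d] is the mass of [A i] surviving up to time [N], and [x m] is that mass
    weighted by f at time [m]. *)
Variables (s k r : nat) (p a b d : R) (x : nat -> R).
Let N := (s + (k * t + r))%N.
Let Th := theta ^+ (k * t).
Hypotheses (st : (s <= t)%N) (rt : (r < t)%N) (p01 : 0 <= p <= 1)
  (b0 : 0 <= b) (aM : 0 <= a <= M * b)
  (x0 : forall m, (m <= N)%N -> 0 <= x m <= d)
  (dapp : `|d - Th * p * a| <= Th * (C * al ^+ k) * b)
  (xapp : forall j n l, (l < t)%N -> (j + n).+1 = k ->
    `|x (s + (j * t + l))%N - theta ^+ ((j + n) * t) * (p * q l) * a| <=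
    theta ^+ ((j + n) * t) * (K2 * (al ^+ j + al ^+ n)) * b).

Let Th0 : 0 < Th. Proof. exact: exprn_gt0. Qed.
Let g := (1 - al)^-1.
Let g0 : 0 < g. Proof. by rewrite invr_gt0 subr_gt0. Qed.

Let ThN : Th <= theta ^- (2 * t) * theta ^+ N.
Proof.
rewrite mulrC ler_pdivlMr ?exprn_gt0// -exprD; apply: ler_wiXn2l => //.
  exact: ltW.
rewrite /N addnCA leq_add2l mul2n -addnn; exact: leq_add st (ltnW rt).
Qed.

Let middle : `|\sum_(m < k * t) x (s + m)%N - (k * t)%:R * limit_mean * p * Th * a|
  <= Th * (theta ^- t * (t%:R * K2 * (2 * g))) * b.
Proof.
rewrite (sum_nat_blocks (fun m => x (s + m)%N)).
(* The candidate limit is spread over the k t times, so that it can be compared term by term;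
   theta^{-t} stands for the cycle missing from j + n = k - 1. *)
have -> : (k * t)%:R * limit_mean * p * Th * a =
    \sum_(j < k) \sum_(l < t) (Th * theta ^- t * (p * q l) * a).
  under eq_bigr do rewrite -mulr_suml -mulr_sumr -mulr_sumr.
  rewrite sumr_const card_ord /limit_mean natrM -[RHS]mulr_natl.
  by field; rewrite !gt_eqF// exprn_gt0.
rewrite -sumrB (le_trans (ler_norm_sum _ _ _))//.
apply: (@le_trans _ _ (\sum_(j < k) \sum_(l < t)
    (Th * theta ^- t * (K2 * (al ^+ j + al ^+ (k - j.+1))) * b))).
  apply: ler_sum => j _; rewrite -sumrB (le_trans (ler_norm_sum _ _ _))//.
  apply: ler_sum => l _.
  have jk : (j + (k - j.+1)).+1 = k by rewrite -addSn subnKC.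
  have -> : Th * theta ^- t = theta ^+ ((j + (k - j.+1)) * t).
    rewrite /Th -[in LHS]jk mulSnr exprD mulfK// gt_eqF// exprn_gt0//.
  exact: xapp.
under eq_bigr do rewrite sumr_const card_ord.
have s1 := sum_geometric_le al k al0 al1.
have -> : \sum_(j < k) (Th * theta ^- t * (K2 * (al ^+ j + al ^+ (k - j.+1))) * b *+ t)
    = Th * (theta ^- t * (t%:R * K2 * (2 * \sum_(j < k) al ^+ j))) * b.
  rewrite sumrMnl -mulr_suml -mulr_sumr -mulr_sumr big_split/=.
  (* The errors from the early and the late stretch are mirror images, so both are bounded by the
     same geometric series. *)
  have -> : \sum_(j < k) al ^+ (k - j.+1) = \sum_(j < k) al ^+ j.
    by rewrite [RHS](reindex_inj rev_ord_inj).
  by rewrite -mulr_natl; ring.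
rewrite ler_wpM2r// ler_pM2l// ler_pM2l// ler_wpM2l ?mulr_ge0 ?ler0n//.
by rewrite ler_pM2l.
Qed.

Let d_le : 0 <= d <= Th * (M + C) * b.
Proof.
have /andP[x00 x0d] := x0 0%N isT; rewrite (le_trans x00 x0d)/=.
have /andP[p0 p1] := p01; have /andP[a0 aMb] := aM.
have ak : al ^+ k <= 1 by rewrite exprn_ile1 ?(ltW al0) ?(ltW al1).
have h1 : Th * (p * a) <= Th * (M * b).
  by rewrite ler_pM2l// (le_trans _ aMb)// ler_piMl.
have h2 : Th * (C * al ^+ k) * b <= Th * C * b.
  by rewrite ler_wpM2r// ler_pM2l// ler_piMr.
have := dapp; rewrite ler_norml => /andP[_]; rewrite lerBlDl => h.
have -> : Th * (M + C) * b = Th * (M * b) + Th * C * b by ring.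
by apply: (le_trans h); rewrite -mulrA lerD.
Qed.

Let B := theta ^- t * Q.
Let I1 := 2 * t%:R * (1 + B) * (M + C).
Let I2 := theta ^- t * (t%:R * K2 * (2 * g)).
Let I3 := t%:R * B * C * g.
Let I4 := C * t%:R * (g + 2).

Let I_ge0 : [/\ 0 <= I1, 0 <= I2, 0 <= I3 & 0 <= I4].
Proof.
have tt := ltW tR0; have gg := ltW g0; have hh := ltW tht0.
have B0 : 0 <= B by have /andP[L0 LB] := limit_mean_bounds; exact: le_trans LB.
have n2 : 0 <= 2 :> R := ler0n _ 2.
split.
- exact: mulr_ge0 (mulr_ge0 (mulr_ge0 n2 tt) (addr_ge0 ler01 B0)) (addr_ge0 M0 C0).
- exact: mulr_ge0 hh (mulr_ge0 (mulr_ge0 tt K20) (mulr_ge0 n2 gg)).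
- exact: mulr_ge0 (mulr_ge0 (mulr_ge0 tt B0) C0) gg.
- exact: mulr_ge0 (mulr_ge0 C0 tt) (addr_ge0 gg n2).
Qed.

Let error_constE : error_const = theta ^- (2 * t) * (I1 + I2 + I3 + I4).
Proof. by []. Qed.

Let scaled (e : R) : e <= I1 + I2 + I3 + I4 ->
  Th * e * b <= error_const * theta ^+ N * b.
Proof.
move=> eI; rewrite ler_wpM2r// error_constE.
have [h1 h2 h3 h4] := I_ge0.
have I0 := addr_ge0 (addr_ge0 (addr_ge0 h1 h2) h3) h4.
apply: (@le_trans _ _ (Th * (I1 + I2 + I3 + I4))); first by rewrite ler_pM2l.
by rewrite mulrAC ler_wpM2r.
Qed.

Let kt_al : (k * t)%:R * al ^+ k <= t%:R * g.
Proof. by rewrite natrM mulrAC mulrC ler_pM2l// natr_expr_le. Qed.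

(** The error splits into three: [T1] for the times before and after the full cycles, [mid] for the
    full cycles, and [T3] for replacing Th p a by [d]. *)
Lemma class_mean_error :
  `|\sum_(m < N.+1) x m - N.+1%:R * limit_mean * d| <= error_const * theta ^+ N * b.
Proof.
have /andP[d0 dle] := d_le; have /andP[L0 LB] := limit_mean_bounds.
have B0 : 0 <= B := le_trans L0 LB.
move: limit_mean L0 LB middle => L L0 LB mid.
have NE : N.+1 = (s + (k * t + r.+1))%N by rewrite /N -!addnS.
have sum_ext n (F : nat -> nat) : (forall m, (m < n)%N -> (F m <= N)%N) ->
    0 <= \sum_(m < n) x (F m) <= n%:R * d.
  move=> FN; apply/andP; split.
    by apply: sumr_ge0 => m _; case/andP: (x0 _ (FN _ (ltn_ord m))).
  rewrite -[X in X%:R]card_ord mulr_natl -sumr_const; apply: ler_sum => m _.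
  by case/andP: (x0 _ (FN _ (ltn_ord m))).
have /andP[s10 s1d] := sum_ext s id (fun m ms => ltnW (leq_trans ms (leq_addr _ _))).
have /andP[s30 s3d] : 0 <= \sum_(m < r.+1) x (s + (k * t + m))%N <= r.+1%:R * d.
  by apply: (sum_ext r.+1 (fun m => s + (k * t + m))%N) => m; rewrite ltnS /N !leq_add2l.
(* The bound uses s <= t and r + 1 <= t: there are at most 2t boundary times. *)
have sr : (s + r.+1)%:R <= 2 * t%:R :> R.
  by rewrite -natrM ler_nat mul2n -addnn leq_add.
rewrite NE big_split_ord/= big_split_ord/=.
set S1 := \sum_(m < s) _ in s10 s1d *; set S3 := \sum_(m < r.+1) _ in s30 s3d *.
set S2 := \sum_(m < k * t) _ in mid *.
have -> : S1 + (S2 + S3) - (s + (k * t + r.+1))%:R * L * d =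
   (S1 + S3 - (s + r.+1)%:R * (L * d)) + (S2 - (k * t)%:R * L * p * Th * a) +
   (k * t)%:R * L * (Th * p * a - d) by rewrite !natrD; ring.
have T1 : `|S1 + S3 - (s + r.+1)%:R * (L * d)| <= Th * I1 * b.
  apply: (@le_trans _ _ (2 * t%:R * (1 + B) * d)); last first.
    have tb : 0 <= 2 * t%:R * (1 + B) by rewrite !mulr_ge0 ?addr_ge0 ?ler0n.
    have := ler_wpM2l tb dle; rewrite /I1; congr (_ <= _); ring.
  have S13 : S1 + S3 <= 2 * t%:R * d.
    by rewrite (le_trans (lerD s1d s3d))// -mulrDl -natrD ler_wpM2r.
  have Ld : (s + r.+1)%:R * (L * d) <= 2 * t%:R * (B * d).
    by apply: ler_pM => //; [exact: mulr_ge0|exact: ler_wpM2r].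
  have Ld0 : 0 <= (s + r.+1)%:R * (L * d) := mulr_ge0 (ler0n _ _) (mulr_ge0 L0 d0).
  have t2 : 0 <= 2 * t%:R :> R := mulr_ge0 (ler0n _ 2) (ltW tR0).
  have tBd := mulr_ge0 t2 d0.
  have tBd' := mulr_ge0 t2 (mulr_ge0 B0 d0).
  have S130 := addr_ge0 s10 s30.
  have -> : 2 * t%:R * (1 + B) * d = 2 * t%:R * d + 2 * t%:R * (B * d) by ring.
  move: S13 Ld Ld0 tBd tBd' S130.
  move: (S1 + S3) (_%:R * (L * d)) (_ * d) (_ * (B * d)) => u v w z *.
  by rewrite ler_norml; apply/andP; split; lra.
(* The number k t of times is absorbed by al^k, so this error stays bounded relative to Th b. *)
have T3 : `|(k * t)%:R * L * (Th * p * a - d)| <= Th * I3 * b.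
  have kL : 0 <= (k * t)%:R * L by rewrite mulr_ge0 ?ler0n.
  rewrite normrM (ger0_norm kL) distrC.
  apply: (@le_trans _ _ ((k * t)%:R * L * (Th * (C * al ^+ k) * b))).
    by rewrite ler_wpM2l.
  have -> : (k * t)%:R * L * (Th * (C * al ^+ k) * b) =
    Th * (((k * t)%:R * al ^+ k) * (L * C)) * b by ring.
  rewrite ler_wpM2r// ler_pM2l//.
  have -> : I3 = t%:R * g * (B * C) by rewrite /I3; ring.
  have LC : 0 <= L * C by rewrite mulr_ge0.
  apply: ler_pM => //; last by rewrite ler_wpM2r.
  by rewrite mulr_ge0 ?ler0n// exprn_ge0 ?(ltW al0).
have [h1 h2 h3 h4] := I_ge0.
apply: (@le_trans _ _ (Th * (I1 + I2 + I3) * b)); last first.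
  by apply: scaled; rewrite lerDl.
have -> : Th * (I1 + I2 + I3) * b = Th * I1 * b + Th * I2 * b + Th * I3 * b by ring.
apply: (le_trans (ler_normD _ _)).
apply: lerD; last exact: T3.
exact: le_trans (ler_normD _ _) (lerD T1 mid).
Qed.

(** The error in [dapp] is geometric in [k], and N + 1 <= (k+2)t, so (N+1) al^k is bounded; this
    produces the division by N + 1. *)
Lemma class_survival_lower :
  Th * p * a <= d + error_const * theta ^+ N * b / N.+1%:R.
Proof.
have N0 : 0 < N.+1%:R :> R by rewrite ltr0n.
have h : Th * p * a <= d + Th * (C * al ^+ k) * b.
  by have := dapp; rewrite ler_norml lerBrDr => /andP[+ _]; lra.
apply: (le_trans h); rewrite lerD2l ler_pdivlMr//.
have -> : Th * (C * al ^+ k) * b * N.+1%:R = Th * (C * (N.+1%:R * al ^+ k)) * b.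
  by ring.
apply: scaled; have [h1 h2 h3 h4] := I_ge0.
apply: (@le_trans _ _ I4); last by rewrite lerDr !addr_ge0.
rewrite /I4 -mulrA ler_wpM2l//.
apply: (@le_trans _ _ (((k * t)%:R + 2 * t%:R) * al ^+ k)).
  rewrite ler_wpM2r ?exprn_ge0 ?(ltW al0)// -natrM -natrD ler_nat /N.
  by rewrite addnCA -addnS leq_add2l mul2n -addnn -addnS leq_add.
rewrite mulrDl mulrDr lerD// [leRHS]mulrC ler_piMr ?mulr_ge0 ?ler0n//.
by rewrite exprn_ile1 ?(ltW al0) ?(ltW al1).
Qed.

End cycle_sums.

(* Once the numerator error is compared with the denominator D, the lower bound
   on D turns it into an error relative to a; the ratio itself is at most 1, which
   pays for the defect in that lower bound. *)
Lemma ratio_bound (R : realType) (n D a b L B K c Mt h o tt : R) :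
  (0 < n -> 0 < D -> 0 < a -> 0 <= b -> 0 < c -> 0 < h -> 0 <= K ->
  0 <= L <= B -> 0 <= o <= n * D -> 0 <= Mt -> a <= Mt * b -> 0 <= tt ->
  (n <= tt) \/
    (`|o - n * L * D| <= K * h * b /\ c * h * a <= D + K * h * b / n) ->
  `|o / (n * D) - L| <= ((2 + B) * K / c + (1 + B) * Mt * tt) * b / (n * a))%R.
Proof.
move=> n0 D0 a0 b0 c0 h0 K0 /andP[L0 LB] /andP[u0 uD] Mt0 aM tt0 H.
have ND : (0 < n * D)%R by rewrite mulr_gt0.
have rE : (`|o / (n * D) - L| * (n * D) = `|o - n * L * D|)%R.
  rewrite -{2}(gtr0_norm ND) -normrM mulrBl divfK ?gt_eqF//.
  by congr (`| _ |)%R; ring.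
(* The a priori bound: the ratio lies in [0,1] and [L] in [0,B]. *)
have r1 : (`|o / (n * D) - L| <= 1 + B)%R.
  rewrite (le_trans (ler_normB _ _))// lerD ?(ger0_norm L0)//.
  by rewrite ger0_norm ?divr_ge0 ?(ltW ND)// ler_pdivrMr// mul1r.
move: rE r1; move: (`|o / (n * D) - L|)%R (normr_ge0 (o / (n * D) - L)%R) => rho r0 rE r1.
have B0 : (0 <= B)%R by exact: le_trans LB.
have e1 : (0 <= (2 + B) * K / c)%R.
  by rewrite divr_ge0 ?(ltW c0)// mulr_ge0// addr_ge0 ?ler0n.
have e2 : (0 <= (1 + B) * Mt * tt)%R by rewrite !mulr_ge0// addr_ge0 ?ler01.
have eqW (u v : R) : u = v -> (u <= v)%R by move->.
rewrite ler_pdivlMr ?mulr_gt0//.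
(* For n <= tt the a priori bound suffices, since n a <= tt Mt b. *)
have [ntt|[h1 h2]] := H.
  apply: (@le_trans _ _ ((1 + B) * Mt * tt * b)%R); last by rewrite ler_wpM2r// lerDr.
  have -> : ((1 + B) * Mt * tt * b = (1 + B) * (tt * (Mt * b)))%R by ring.
  by rewrite ler_pM ?mulr_ge0 ?(ltW n0) ?(ltW a0)// ler_pM ?(ltW n0) ?(ltW a0).
apply: (@le_trans _ _ ((2 + B) * K / c * b)%R); last first.
  by rewrite ler_wpM2r// lerDl.
have Kb : (0 <= K * h * b)%R by rewrite !mulr_ge0// ltW.
rewrite -(ler_pM2r c0) -(ler_pM2r h0).
have -> : ((2 + B) * K / c * b * c * h = (2 + B) * (K * h * b))%R.
  by field; rewrite gt_eqF.
(* The lower bound on [D] is multiplied by rho n. The product rho n D is the numerator error, at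
   most K h b, and the defect costs at most (1 + B) K h b, whence the constant 2 + B. *)
have h3 : (rho * (c * h * a) * n <= rho * (D + K * h * b / n) * n)%R.
  by rewrite ler_wpM2r ?(ltW n0)// ler_wpM2l.
have -> : (rho * (n * a) * c * h = rho * (c * h * a) * n)%R by ring.
apply: (le_trans h3).
have -> : (rho * (D + K * h * b / n) * n = rho * (n * D) + rho * (K * h * b))%R.
  by field; rewrite gt_eqF.
rewrite rE; apply: (le_trans (lerD h1 (ler_wpM2r Kb r1))).
by apply: eqW; ring.
Qed.

(** * Nonnegative observables *)

Section assembly.
Context {dE dO : measure_display} {E : measurableType dE}
  {Omega : measurableType dO} {R : realType}.
Context (X : nat -> Omega -> option E) (P : R.-pker (option E) ~> Omega).
Context (t : nat) (A : nat -> set E).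
Context (V eta : E -> R) (theta0 CQ alpha : R) (nu : probability E R).
Hypothesis XP : absorbed_markov_chain X P.
Hypothesis AP : periodicity X P t A.
Hypothesis HP : assumptionH X P t A V eta theta0 CQ alpha nu.
Local Notation S := (semigroup X P).
Local Notation p := (survival_mass X P nu).

Let t0 : (0 < t)%N := period_gt0 AP.
Let mA i : (i < t)%N -> measurable (A i) := class_measurable AP (i := i).
Let th0 : (0 < theta0)%R := theta0_gt0 HP.
Let th1 : (theta0 <= 1)%R := theta0_le1 HP.
Let nnmfun1 : nnmfun (cst 1 : E -> \bar R).
Proof. by split. Qed.
Let nnmfun_S n g : nnmfun g -> nnmfun (S n g).
Proof. exact: nnmfun_semigroup. Qed.
Let Sadd m n g : nnmfun g -> S (m + n) g = S m (S n g).
Proof. exact: semigroup_add. Qed.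

Lemma survival_antitone m n x : (m <= n)%N -> S n (cst 1) x <= S m (cst 1) x.
Proof.
move=> mn; rewrite -(subnKC mn) (Sadd _ _ _ nnmfun1).
apply: (il_le (semigroup_integral_like X P XP m x)) => //; first exact: nnmfun_S.
by move=> y; exact: semigroup_le1.
Qed.

Lemma survival_mass_antitone m n : (m <= n)%N -> (p n <= p m)%R.
Proof.
move=> mn; rewrite -lee_fin.
rewrite -(survival_massE _ _ _ _ _ _ _ _ _ _ XP AP HP n).
rewrite -(survival_massE _ _ _ _ _ _ _ _ _ _ XP AP HP m).
apply: (il_le (nu_integral_like nu)); [exact: nnmfun_S|exact: nnmfun_S|].
by move=> x; exact: survival_antitone.
Qed.

(** Integrating [survival_approx] with r = 0 against [nu] gives theta0^{kt} nu(eta) <= p_{kt} +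
    theta0^{kt} CQ alpha^k nu(V). A large [k] makes p_{kt} positive, and by monotonicity p_{kt}
    bounds all p_r with r < t from below. *)
Lemma survival_mass_lower : exists c : R, (0 < c)%R /\
  forall r, (r < t)%N -> (c <= p r)%R.
Proof.
have [M [M0 etaM]] := eta_le_V _ _ _ _ _ _ _ _ _ _ HP.
have etaP := nnmfun_eta _ _ _ _ _ _ _ _ _ _ HP.
have VP := nnmfun_V _ _ _ _ _ _ _ _ _ _ HP.
have [nuetaE _] := nu_fin _ _ _ _ _ _ _ _ _ _ AP HP M (EFin \o eta) (ltW M0) etaP
  (fun y _ => etaM y).
have nVE := nuVE _ _ _ _ _ _ _ _ _ _ HP.
have nV0 := nuV_ge0 _ _ _ _ _ _ _ _ _ _ HP.
set h := fine _ in nuetaE.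
have h0 : (0 < h)%R by have := nu_eta HP; rewrite nuetaE lte_fin.
have p0 : p 0%N = 1%R.
  rewrite /survival_mass semigroup0// integral_cst//.
  by rewrite [X in fine (_ * X)](probability_setT nu) mule1.
have al0 := alpha_gt0 HP; have al1 := alpha_lt1 HP.
pose B := (CQ * nuV V nu * (1 - alpha)^-1)%R.
have B0 : (0 <= B)%R.
  by rewrite /B !mulr_ge0 ?(CQ_ge0 HP)// invr_ge0 subr_ge0 ltW.
(* By [natr_expr_le], CQ alpha^k nu(V) <= B / k, which is below h = nu(eta) once k > B / h. *)
have [k kgt0 kB] : exists2 k, (0 < k)%N & (B / h < k%:R)%R.
  by exists (Num.truncn (B / h)).+1 => //; exact: truncnS_gt.
exists (p (k * t)%N); split; last first.
  move=> r rt; apply: survival_mass_antitone; rewrite (leq_trans (ltnW rt))//.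
  by rewrite leq_pmull// (leq_trans _ kgt0).
have thk : (0 < theta0 ^+ (k * t))%R by exact: exprn_gt0.
have ak0 : (0 <= theta0 ^+ (k * t) * (CQ * alpha ^+ k))%R.
  by rewrite mulr_ge0 ?(ltW thk)// mulr_ge0 ?(CQ_ge0 HP)// exprn_ge0// ltW.
have ap := survival_approx _ _ _ _ _ _ _ _ _ _ XP AP HP k 0.
have le1 : \int[nu]_x ((theta0 ^+ (k * t) * p 0%N)%:E * (EFin \o eta) x) <=
    \int[nu]_x (S (k * t) (cst 1) \+
      (fun x => (theta0 ^+ (k * t) * (CQ * alpha ^+ k))%:E * (EFin \o V) x)) x.
  apply: (nu_le_class _ _ _ _ _ _ _ _ _ _ AP HP).
  - by apply: nnmfunZ => //; rewrite p0 mulr1 ltW.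
  - by apply: nnmfunD; [exact: nnmfun_S|exact: nnmfunZ].
  - by move=> x /ap[_]; rewrite semigroup0.
have IL := nu_integral_like nu.
move: le1; rewrite (il_Z IL) //; last by rewrite p0 mulr1 ltW.
rewrite (il_D IL)//; [|exact: nnmfun_S|exact: nnmfunZ].
rewrite (il_Z IL)// nuetaE nVE (survival_massE _ _ _ _ _ _ _ _ _ _ XP AP HP).
rewrite -!EFinM -EFinD lee_fin p0 mulr1 => le1.
have kal := natr_expr_le _ alpha k al0 al1.
have k0 : (0 < k%:R :> R)%R by rewrite ltr0n.
have : (B / k%:R < h)%R by rewrite ltr_pdivrMr// mulrC -ltr_pdivrMr.
have : (CQ * alpha ^+ k * nuV V nu <= B / k%:R)%R.
  rewrite ler_pdivlMr//.
  have -> : (CQ * alpha ^+ k * nuV V nu * k%:R =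
    CQ * nuV V nu * (k%:R * alpha ^+ k))%R by ring.
  by rewrite ler_wpM2l// mulr_ge0 ?(CQ_ge0 HP).
move=> h1 h2; have h3 := le_lt_trans h1 h2.
have h4 : (theta0 ^+ (k * t) * (CQ * alpha ^+ k * nuV V nu) < theta0 ^+ (k * t) * h)%R.
  by rewrite ltr_pM2l.
rewrite -(ltrD2r (theta0 ^+ (k * t) * (CQ * alpha ^+ k) * nuV V nu)%R) add0r.
by apply: lt_le_trans le1; rewrite -mulrA.
Qed.

Lemma cover_integral (mu : probability E R) (g : E -> \bar R) : nnmfun g ->
  \int[mu]_x g x = \sum_(i < t) \int[mu]_(x in A i) g x.
Proof.
move=> [g0 mg].
have -> : [set: E] = \big[setU/set0]_(i <- index_enum 'I_t) A i.
  by rewrite -(class_cover AP) bigcup_mkord.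
rewrite (@ge0_integral_bigsetU _ _ _ _ _ (fun i : 'I_t => A i))//.
- by move=> i; exact: mA.
- exact: index_enum_uniq.
- move=> i j _ _ ij; apply/val_inj.
  exact: (class_disjoint AP (ltn_ord i) (ltn_ord j) ij).
- exact: measurable_funTS.
Qed.

(** * Occupation and survival under a general initial law *)

Section mean.
Variables (M c : R).
Hypotheses (M0 : (0 < M)%R) (etaM : forall x, (eta x <= M * V x)%R)
  (c0 : (0 < c)%R) (cp : forall r, (r < t)%N -> (c <= p r)%R).
Variable f : E -> \bar R.
Hypotheses (mf : measurable_fun setT f) (f01 : forall x, 0 <= f x <= 1).
Variable mu : probability E R.
Hypothesis Vfin : forall i, (i < t)%N ->
  \int[mu]_(x in A i) S (t - i) (EFin \o V) x < +oo.

Let fP : nnmfun f.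
Proof. by split => // x; case/andP: (f01 x). Qed.

(** For m <= N this is E_x[f(X_m); N < tau], by [alive_integral]. *)
Definition occupation N m (x : E) := S m (f \* S (N - m) (cst 1)) x.

Lemma nnmfun_occupation N m : nnmfun (occupation N m).
Proof. by apply/nnmfun_S/nnmfunM => //; exact: nnmfun_S. Qed.

Lemma occupation_le N m x : (m <= N)%N -> occupation N m x <= S N (cst 1) x.
Proof.
move=> mN; rewrite /occupation -[in leRHS](subnKC mN) (Sadd _ _ _ nnmfun1).
apply: (il_le (semigroup_integral_like X P XP m x)).
- by apply: nnmfunM => //; exact: nnmfun_S.
- exact: nnmfun_S.
- move=> y /=; rewrite -[leRHS]mul1e lee_wpmul2r//.
    by have [] := nnmfun_S (N - m) _ nnmfun1.
  by case/andP: (f01 y).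
Qed.

Definition class_surv i N : R := fine (\int[mu]_(x in A i) S N (cst 1) x).
Definition class_occ i N m : R := fine (\int[mu]_(x in A i) occupation N m x).

Lemma class_surv_fin i N : (i < t)%N ->
  \int[mu]_(x in A i) S N (cst 1) x = (class_surv i N)%:E /\
  (0 <= class_surv i N)%R.
Proof.
move=> it.
have SP := nnmfun_S N _ nnmfun1.
have y0 : 0 <= \int[mu]_(x in A i) S N (cst 1) x by apply: integral_ge0 => x _; case: SP.
have yle : \int[mu]_(x in A i) S N (cst 1) x <= mu (A i).
  rewrite -[leRHS]mul1e -integral_cst; last exact: mA.
  apply: ge0_le_integral => //.
  - exact: mA.
  - by move=> x _; case: SP.
  - by apply: measurable_funTS; case: SP.
  - by move=> x _; exact: semigroup_le1.
have yfin : \int[mu]_(x in A i) S N (cst 1) x \is a fin_num.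
  rewrite (ge0_fin_numE y0) (le_lt_trans yle)//.
  by rewrite (le_lt_trans (probability_le1 mu (mA _ it)) (ltry _)).
by rewrite /class_surv (fineK yfin) (fine_ge0 y0).
Qed.

Lemma class_occ_fin i N m : (i < t)%N -> (m <= N)%N ->
  \int[mu]_(x in A i) occupation N m x = (class_occ i N m)%:E /\
  (0 <= class_occ i N m <= class_surv i N)%R.
Proof.
move=> it mN.
have SP := nnmfun_S N _ nnmfun1; have OP := nnmfun_occupation N m.
have y0 : 0 <= \int[mu]_(x in A i) occupation N m x.
  by apply: integral_ge0 => x _; case: OP.
have yle : \int[mu]_(x in A i) occupation N m x <= (class_surv i N)%:E.
  rewrite -(class_surv_fin _ N it).1; apply: ge0_le_integral => //.
  - exact: mA.
  - by move=> x _; case: OP.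
  - by apply: measurable_funTS; case: OP.
  - by apply: measurable_funTS; case: SP.
  - by move=> x _; exact: occupation_le.
have yfin : \int[mu]_(x in A i) occupation N m x \is a fin_num.
  by rewrite (ge0_fin_numE y0) (le_lt_trans yle (ltry _)).
rewrite /class_occ (fineK yfin) (fine_ge0 y0); split => //=.
by rewrite -lee_fin (fineK yfin).
Qed.

Let q := weight X P t eta nu f.
Let Q := (M * growth V CQ nu M * nuV V nu)%R.
Let K2 := cycle_const V CQ nu M.

Lemma weight_bounds l : (l < t)%N -> (0 <= q l <= Q)%R.
Proof.
move=> lt.
by have [] := weightE _ _ _ _ _ _ _ _ _ _ XP AP HP _ M0 etaM _ mf f01 _ (ltnW lt).
Qed.

Definition mean_limit : R := limit_mean R theta0 t q.
Definition mean_const : R := error_const R theta0 alpha CQ M K2 Q t.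

Lemma class_mean i N : (i < t)%N -> (t <= N)%N ->
  (`|\sum_(m < N.+1) class_occ i N m - N.+1%:R * mean_limit * class_surv i N| <=
     mean_const * theta0 ^+ N * class_V X P t A V mu i)%R /\
  (c * theta0 ^+ N * (theta0 ^- (t - i) * class_eta X P t A eta mu i) <=
     class_surv i N + mean_const * theta0 ^+ N * class_V X P t A V mu i / N.+1%:R)%R.
Proof.
move=> it tN.
(* After the t - i steps leading to [A 0], the remaining time is divided by [t]; t <= N ensures that
   the subtraction is exact. *)
pose n := (N - (t - i))%N.
have NE : N = (t - i + (n %/ t * t + n %% t))%N.
  by rewrite -divn_eq /n subnKC// (leq_trans (leq_subr _ _)).
have rt : (n %% t < t)%N by rewrite ltn_mod.
have [_ b0] := class_VE _ _ _ _ _ _ _ _ _ _ XP HP mu i (Vfin _ it).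
have [_ aM] := class_etaE _ _ _ _ _ _ _ _ _ _ XP AP HP _ M0 etaM mu i it (Vfin _ it).
have p0 := survival_mass_ge0 _ _ _ _ _ _ _ _ _ _ XP AP HP.
have p1 := survival_mass_le1 _ _ _ _ _ _ _ _ _ _ XP AP HP.
have p01 r : (0 <= p r <= 1)%R by rewrite p0 p1.
have K20 := cycle_const_ge0 _ _ _ _ _ _ _ _ _ _ HP _ M0.
have C0 := CQ_ge0 HP; have al0 := alpha_gt0 HP; have al1 := alpha_lt1 HP.
move: (n %/ t)%N (n %% t)%N NE rt => k r NE rt.
have [_ _ dapp] := class_survival _ _ _ _ _ _ _ _ _ _ XP AP HP _ M0 etaM mu i it
  (Vfin _ it) k r.
have xapp j n' l : (l < t)%N -> (j + n').+1 = k ->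
    (`|class_occ i N (t - i + (j * t + l)) -
       theta0 ^+ ((j + n') * t) * (p r * q l) * class_eta X P t A eta mu i| <=
     theta0 ^+ ((j + n') * t) * (K2 * (alpha ^+ j + alpha ^+ n')) *
     class_V X P t A V mu i)%R.
  move=> lt jn; have [_ _] := class_cycle _ _ _ _ _ _ _ _ _ _ XP AP HP _ M0 etaM _ mf f01
    mu i j n' l r it lt (Vfin _ it).
  rewrite /class_occ /occupation.
  have -> : (N - (t - i + (j * t + l)) = t - l + (n' * t + r))%N => //.
  rewrite NE subnDl -jn mulSn mulnDl.
  have -> : (t + (j * t + n' * t) + r = t - l + (n' * t + r) + (j * t + l))%N.
    by have := subnK (ltnW lt); move: (t - l)%N => u <-; ring.
  by rewrite addnK.
have x0 m : (m <= t - i + (k * t + r))%N ->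
    (0 <= class_occ i N m <= class_surv i N)%R.
  by rewrite -NE => mN; have [] := class_occ_fin _ _ _ it mN.
rewrite -NE -/(class_surv i N) in dapp.
have st := leq_subr i t.
have h1 := class_mean_error _ _ _ _ _ _ _ _ _ th0 th1 al0 al1 C0 (ltW M0) K20 t0
    weight_bounds _ k r (p r) _ _ _ _ st rt (p01 r) b0 aM x0 dapp xapp.
have h2 := class_survival_lower _ _ _ _ _ _ _ _ _ th0 th1 al0 al1 C0 (ltW M0) K20 t0
    weight_bounds _ k r (p r) _ _ _ st rt b0 dapp.
rewrite -NE in h1 h2; split; first exact: h1.
apply: le_trans h2; have /andP[a0 _] := aM.
rewrite mulrA ler_wpM2r//.
have thk e : (0 < theta0 ^+ e)%R by exact: exprn_gt0.
(* N >= k t + (t - i) and theta0 <= 1 give theta0^N theta0^{-(t-i)} <= theta0^{kt}; then c <=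
   p_r. *)
apply: (@le_trans _ _ (c * theta0 ^+ (k * t))%R).
  rewrite -mulrA ler_pM2l// ler_pdivrMr// -exprD ler_wiXn2l ?(ltW th0)//.
  by rewrite NE addnA (addnC (k * t)%N) leq_addr.
by rewrite mulrC ler_pM2l// cp.
Qed.

Local Notation sumV := (\sum_(i < t) class_V X P t A V mu i)%R.
Local Notation sum_eta :=
  (\sum_(i < t) theta0 ^- (t - i) * class_eta X P t A eta mu i)%R.

Definition surv N : R := (\sum_(i < t) class_surv i N)%R.
Definition occ N : R := (\sum_(i < t) \sum_(m < N.+1) class_occ i N m)%R.

Lemma sumV_ge0 : (0 <= sumV)%R.
Proof.
apply: sumr_ge0 => i _.
by have [_] := class_VE _ _ _ _ _ _ _ _ _ _ XP HP mu i (Vfin _ (ltn_ord i)).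
Qed.

(** This comparison makes the a priori bound usable for the finitely many N < t. *)
Lemma sum_eta_le : (sum_eta <= theta0 ^- t * M * sumV)%R.
Proof.
rewrite mulr_sumr; apply: ler_sum => i _; rewrite -mulrA.
have [_ /andP[a0 aM]] := class_etaE _ _ _ _ _ _ _ _ _ _ XP AP HP _ M0 etaM mu i
  (ltn_ord i) (Vfin _ (ltn_ord i)).
apply: ler_pM => //; first by rewrite invr_ge0 exprn_ge0// ltW.
by rewrite lef_pV2 ?posrE ?exprn_gt0// ler_wiXn2l ?leq_subr ?(ltW th0).
Qed.

Lemma surv_integral N : \int[mu]_x S N (cst 1) x = (surv N)%:E.
Proof.
rewrite (cover_integral mu _ (nnmfun_S N _ nnmfun1)) /surv -sumEFin.
by apply: eq_bigr => i _; exact: (class_surv_fin i N (ltn_ord i)).1.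
Qed.

Lemma occ_integral N :
  \int[mu]_x (\sum_(m < N.+1) occupation N m x) = (occ N)%:E.
Proof.
rewrite cover_integral; last by apply: nnmfun_sum => m; exact: nnmfun_occupation.
rewrite /occ -sumEFin; apply: eq_bigr => i _.
rewrite ge0_integral_sum.
- rewrite -sumEFin; apply: eq_bigr => m _.
  exact: (class_occ_fin i N m (ltn_ord i) (ltn_ord m)).1.
- exact: mA.
- by move=> m; apply: measurable_funTS; case: (nnmfun_occupation N m).
- by move=> m x _; case: (nnmfun_occupation N m).
Qed.

Lemma surv_antitone N1 N2 : (N1 <= N2)%N -> (surv N2 <= surv N1)%R.
Proof.
move=> N12; rewrite -lee_fin -!surv_integral; apply: ge0_le_integral => //.
- by move=> x _; case: (nnmfun_S N2 _ nnmfun1).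
- by case: (nnmfun_S N2 _ nnmfun1).
- by case: (nnmfun_S N1 _ nnmfun1).
- by move=> x _; exact: survival_antitone.
Qed.

Lemma occ_bounds N : (0 <= occ N <= N.+1%:R * surv N)%R.
Proof.
have h (i : 'I_t) (m : 'I_N.+1) := (class_occ_fin i N m (ltn_ord i) (ltn_ord m)).2.
apply/andP; split.
  by apply: sumr_ge0 => i _; apply: sumr_ge0 => m _; case/andP: (h i m).
rewrite /surv mulr_sumr; apply: ler_sum => i _.
rewrite -[X in X%:R]card_ord mulr_natl -sumr_const; apply: ler_sum => m _.
by case/andP: (h i m).
Qed.

(** The class estimates share the same constants and are linear in [class_V] and [class_eta], so
    they add up over the classes. *)
Lemma total_mean N : (t <= N)%N ->
  (`|occ N - N.+1%:R * mean_limit * surv N| <= mean_const * theta0 ^+ N * sumV)%R /\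
  (c * theta0 ^+ N * sum_eta <=
     surv N + mean_const * theta0 ^+ N * sumV / N.+1%:R)%R.
Proof.
move=> tN; have h (i : 'I_t) := class_mean i N (ltn_ord i) tN.
rewrite /occ /surv !mulr_sumr; split.
  rewrite -sumrB (le_trans (ler_norm_sum _ _ _))//.
  by apply: ler_sum => i _; case: (h i).
rewrite mulr_suml -big_split/=; apply: ler_sum => i _.
by case: (h i).
Qed.

Lemma mean_limit_bounds : (0 <= mean_limit <= theta0 ^- t * Q)%R.
Proof. exact: (limit_mean_bounds _ _ _ _ _ th0 t0 weight_bounds). Qed.

Lemma mean_const_ge0 : (0 <= mean_const)%R.
Proof.
have K20 := cycle_const_ge0 _ _ _ _ _ _ _ _ _ _ HP _ M0.
exact: (error_const_ge0 _ _ _ _ _ _ _ _ _ th0 (alpha_lt1 HP) (CQ_ge0 HP) (ltW M0)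
  K20 t0 weight_bounds).
Qed.

Hypothesis sum_eta_gt0 : (0 < sum_eta)%R.

Let thk k : (0 < theta0 ^+ k)%R.
Proof. exact: exprn_gt0. Qed.

(* Survival is nonincreasing in time, so positivity only has to be checked
   late, where the lower bound of [total_mean] is positive. *)
Lemma surv_gt0 N : (0 < surv N)%R.
Proof.
(* Beyond this threshold the main term of the lower bound exceeds its defect. *)
pose B := (mean_const * sumV / (c * sum_eta))%R.
have [n nB] : exists n, (B < n%:R)%R.
  by exists (Num.truncn B).+1; exact: truncnS_gt.
pose N' := (n + t + N)%N.
apply: lt_le_trans (surv_antitone _ N' (leq_addl _ _)).
have tN' : (t <= N')%N by rewrite /N' addnAC leq_addl.
have [_ h] := total_mean N' tN'.
have ca : (0 < c * sum_eta)%R by rewrite mulr_gt0.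
have nN : (n%:R <= N'.+1%:R :> R)%R.
  by rewrite ler_nat /N' -addnA -addnS leq_addr.
have N0 : (0 < N'.+1%:R :> R)%R by rewrite ltr0n.
have := lt_le_trans nB nN; rewrite /B ltr_pdivrMr// => h1.
have h2 : (mean_const * theta0 ^+ N' * sumV / N'.+1%:R < c * theta0 ^+ N' * sum_eta)%R.
  rewrite ltr_pdivrMr// mulrAC [ltRHS](_ : _ = N'.+1%:R * (c * sum_eta) * theta0 ^+ N')%R.
    by rewrite ltr_pM2r.
  by ring.
rewrite -(ltrD2r (mean_const * theta0 ^+ N' * sumV / N'.+1%:R)%R) add0r.
exact: lt_le_trans h2 h.
Qed.

Definition ratio_const : R :=
  ((2 + theta0 ^- t * Q) * mean_const / c +
   (1 + theta0 ^- t * Q) * (theta0 ^- t * M) * t%:R)%R.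

Lemma ratio_error N :
  (`|occ N / (N.+1%:R * surv N) - mean_limit| <=
   ratio_const * sumV / (N.+1%:R * sum_eta))%R.
Proof.
apply: (ratio_bound R _ _ _ _ _ (theta0 ^- t * Q)%R mean_const c
  (theta0 ^- t * M)%R (theta0 ^+ N)%R _ t%:R) => //.
- exact: surv_gt0.
- exact: sumV_ge0.
- exact: mean_const_ge0.
- exact: mean_limit_bounds.
- exact: occ_bounds.
- by rewrite mulrC divr_ge0 ?(ltW M0) ?(ltW (thk _)).
- exact: sum_eta_le.
- have [tN|Nt] := leqP t N; [right; exact: total_mean|left].
  by rewrite ler_nat.
Qed.

End mean.
End assembly.

Lemma integral_nnmfunB {d} {T : measurableType d} {R : realType}
    (m : {measure set T -> \bar R}) (D : set T) (g h : T -> \bar R) (u v : R) :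
  measurable D -> nnmfun g -> nnmfun h ->
  \int[m]_(x in D) g x = u%:E -> \int[m]_(x in D) h x = v%:E ->
  \int[m]_(x in D) (g x - h x) = (u - v)%:E.
Proof.
move=> mD [g0 mg] [h0 mh] gu hv.
have int (k : T -> \bar R) (w : R) : (forall x, 0 <= k x) ->
    measurable_fun setT k -> \int[m]_(x in D) k x = w%:E -> m.-integrable D k.
  move=> k0 mk kw; apply/integrableP; split; first exact: measurable_funTS.
  by under eq_integral do rewrite gee0_abs//; rewrite kw ltry.
by rewrite integralB// ?gu ?hv//; [exact: int gu|exact: int hv].
Qed.

(** * Signed observables *)

Section signed.
Context {dE dO : measure_display} {E : measurableType dE}
  {Omega : measurableType dO} {R : realType}.
Context (X : nat -> Omega -> option E) (P : R.-pker (option E) ~> Omega).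
Local Notation S := (semigroup X P).

Lemma funeposM (F G : E -> \bar R) : (forall y, 0 <= G y) ->
  (F \* G)^\+ = F^\+ \* G.
Proof.
move=> G0; apply/funext => y; rewrite funeposE /= funeposE.
have [F0|F0] := leP 0 (F y).
  by rewrite max_l// mule_ge0.
by rewrite mul0e max_r// mule_le0_ge0// ltW.
Qed.

Lemma funenegM (F G : E -> \bar R) : (forall y, 0 <= G y) ->
  (F \* G)^\- = F^\- \* G.
Proof.
move=> G0; rewrite -funeposN -[F^\-]funeposN -funeposM//; congr funepos.
by apply/funext => y /=; rewrite mulNe.
Qed.

Lemma ext0_pos (F : E -> \bar R) o : ext0 F^\+ o = maxe (ext0 F o) 0.
Proof. by case: o => [y|]/=; rewrite ?funeposE ?maxxx. Qed.

Lemma ext0_neg (F : E -> \bar R) o : ext0 F^\- o = maxe (- ext0 F o) 0.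
Proof. by case: o => [y|]; rewrite /ext0 ?funenegE ?oppe0 ?maxxx. Qed.

(** A nonnegative factor [G] passes through positive and negative parts, and the integral of a
    signed function is by definition the difference of the integrals of its two parts. *)
Lemma semigroup_signed l (F G : E -> \bar R) x : (forall y, 0 <= G y) ->
  S l (F \* G) x = S l (F^\+ \* G) x - S l (F^\- \* G) x.
Proof.
move=> G0; rewrite -funeposM// -funenegM// /semigroup [LHS]integralE.
by congr (_ - _); apply: eq_integral => w _; rewrite ?ext0_pos ?ext0_neg ?funeposE ?funenegE.
Qed.

End signed.

(** * The conditional expectation and the limit for signed observables *)

Section conditional_mean.
Context {dE dO : measure_display} {E : measurableType dE}
  {Omega : measurableType dO} {R : realType}.
Context (X : nat -> Omega -> option E) (P : R.-pker (option E) ~> Omega).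
Context (t : nat) (A : nat -> set E).
Context (V eta : E -> R) (theta0 CQ alpha : R) (nu : probability E R).
Hypothesis XP : absorbed_markov_chain X P.
Hypothesis AP : periodicity X P t A.
Hypothesis HP : assumptionH X P t A V eta theta0 CQ alpha nu.
Variables (f : E -> R) (mu : probability E R).
Hypotheses (mf : measurable_fun setT f) (f1 : forall x, (-1 <= f x <= 1)%R).
Local Notation S := (semigroup X P).
Local Notation F := (EFin \o f).

Let mX n : measurable_fun setT (X n) := chain_measurable XP n.
Let mF : measurable_fun setT F. Proof. exact/measurable_EFinP. Qed.

Lemma funepos01 x : 0 <= F^\+ x <= 1.
Proof.
have /andP[h1 h2] := f1 x.
by rewrite funepos_ge0 funeposE /= -EFin_max lee_fin ge_max h2 ler01.
Qed.

Lemma funeneg01 x : 0 <= F^\- x <= 1.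
Proof.
have /andP[h1 h2] := f1 x.
by rewrite funeneg_ge0 funenegE /= -EFin_max lee_fin ge_max lerNl h1 ler01.
Qed.

Let mFp : measurable_fun setT F^\+. Proof. exact: measurable_funepos. Qed.
Let mFn : measurable_fun setT F^\-. Proof. exact: measurable_funeneg. Qed.

Lemma law_alive N :
  initial_law P mu (alive R X N) = (surv X P t A mu N)%:E.
Proof.
rewrite -(surv_integral _ _ _ _ XP AP) /initial_law.
by apply: eq_integral => x _; exact: prob_alive.
Qed.

Lemma nnmfun_visits (g : E -> \bar R) N : nnmfun g ->
  nnmfun (fun w => \sum_(m < N.+1) ext0 g (X m w)).
Proof.
by move=> gP; apply: nnmfun_sum => m; exact: nnmfun_comp _ _ (mX m) (nnmfun_ext0 _ gP).
Qed.

Lemma law_occupation (g : E -> \bar R) N : measurable_fun setT g ->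
  (forall x, 0 <= g x <= 1) ->
  \int[initial_law P mu]_(w in alive R X N) (\sum_(m < N.+1) ext0 g (X m w)) =
  (occ X P t A g mu N)%:E.
Proof.
move=> mg g01; have gP : nnmfun g by split => // x; case/andP: (g01 x).
have mA := measurable_alive _ _ XP N.
rewrite initial_law_integral//; last exact: nnmfun_visits.
rewrite -(occ_integral _ _ _ _ XP AP _ mg g01); apply: eq_integral => x _.
rewrite ge0_integral_sum//.
- apply: eq_bigr => m _; rewrite /occupation -alive_integral//.
  by rewrite subnKC// -ltnS.
- move=> m; apply: measurable_funTS.
  exact: (nnmfun_comp _ _ (mX m) (nnmfun_ext0 _ gP)).2.
- by move=> m w _; exact: (nnmfun_ext0 _ gP).1.
Qed.

Lemma cond_expectation_visits N : (0 < surv X P t A mu N)%R ->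
  cond_expectation (initial_law P mu)
    (fun w => (N.+1%:R^-1)%:E * \sum_(0 <= m < N.+1) ext0 F (X m w))
    (alive R X N) =
  (occ X P t A F^\+%E mu N / (N.+1%:R * surv X P t A mu N) -
   occ X P t A F^\-%E mu N / (N.+1%:R * surv X P t A mu N))%:E.
Proof.
move=> D0; rewrite /cond_expectation.
have Fp : nnmfun F^\+ by split => // x; exact: funepos_ge0.
have Fn : nnmfun F^\- by split => // x; exact: funeneg_ge0.
have N0 : (0 <= N.+1%:R^-1 :> R)%R by rewrite invr_ge0 ler0n.
have mA := measurable_alive _ _ XP N.
pose Y (g : E -> \bar R) w := (N.+1%:R^-1)%:E * \sum_(m < N.+1) ext0 g (X m w).
have YP g : nnmfun g -> nnmfun (Y g).
  by move=> gP; apply: nnmfunZ => //; exact: nnmfun_visits.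
have Yint g : measurable_fun setT g -> (forall x, 0 <= g x <= 1) ->
    \int[initial_law P mu]_(w in alive R X N) Y g w =
    (N.+1%:R^-1 * occ X P t A g mu N)%:E.
  move=> mg g01; have gP : nnmfun g by split => // x; case/andP: (g01 x).
  rewrite /Y ge0_integralZl ?lee_fin//.
  - by rewrite law_occupation.
  - by apply: measurable_funTS; case: (nnmfun_visits _ N gP).
  - by move=> w _; case: (nnmfun_visits _ N gP).
(* The split is pointwise; all terms lie in [0,1], so the extended-real differences can be computed
   in [R]. *)
rewrite (eq_integral (fun w => Y F^\+ w - Y F^\- w)); last first.
  move=> w _; rewrite /Y big_mkord.
  have fin (g : E -> \bar R) o : (forall x, 0 <= g x <= 1) -> ext0 g o = (fine (ext0 g o))%:E.
    move=> g01; case: o => [x|]//=; have /andP[g0 g1] := g01 x.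
    by rewrite fineK// ge0_fin_numE// (le_lt_trans g1)// ltry.
  under [X in _ = _ * X - _]eq_bigr do rewrite (fin _ _ funepos01).
  under [X in _ = _ - _ * X]eq_bigr do rewrite (fin _ _ funeneg01).
  rewrite !sumEFin -!EFinM -EFinB -mulrBr EFinM -sumrB -sumEFin; congr (_ * _).
  apply: eq_bigr => m _; rewrite EFinB -(fin _ _ funepos01) -(fin _ _ funeneg01).
  case: (X m w) => [x|]; rewrite /ext0; last by rewrite sube0.
  exact: (congr1 (fun h => h x) (funeposneg F)).
rewrite (integral_nnmfunB _ _ _ _ _ _ mA (YP _ Fp) (YP _ Fn) (Yint _ mFp funepos01)
  (Yint _ mFn funeneg01)).
rewrite [X in _ / X](law_alive N) inver gt_eqF// -EFinM; congr EFin.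
move: D0 (occ _ _ _ _ F^\+%E _ _) (occ _ _ _ _ F^\-%E _ _).
move: (surv _ _ _ _ _ _) => D D0 u v.
by field; rewrite gt_eqF//= addrC natr1 gt_eqF.
Qed.

Section limit.
Variable M : R.
Hypotheses (M0 : (0 < M)%R) (etaM : forall x, (eta x <= M * V x)%R).

Lemma limit_signed :
  (theta0 ^- t / t%:R)%:E * \sum_(0 <= l < t)
     \int[nu]_x S l (fun y => (f y)%:E * S (t - l) (EFin \o eta) y) x =
  (mean_limit X P t eta theta0 nu F^\+%E - mean_limit X P t eta theta0 nu F^\-%E)%:E.
Proof.
have Fp : nnmfun F^\+ by split => // x; exact: funepos_ge0.
have Fn : nnmfun F^\- by split => // x; exact: funeneg_ge0.
rewrite /mean_limit /limit_mean -mulrBr [RHS]EFinM; congr (_ * _).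
rewrite -sumrB -sumEFin big_mkord; apply: eq_bigr => l _.
have etaP := nnmfun_eta _ _ _ _ _ _ _ _ _ _ HP.
have GP := nnmfun_semigroup _ _ XP (t - l) _ etaP.
have w g (gP : nnmfun g) :=
  nnmfun_semigroup _ _ XP l _ (nnmfunM _ _ gP GP).
have wp := weightE _ _ _ _ _ _ _ _ _ _ XP AP HP _ M0 etaM _ mFp funepos01 _
  (ltnW (ltn_ord l)).
have wn := weightE _ _ _ _ _ _ _ _ _ _ XP AP HP _ M0 etaM _ mFn funeneg01 _
  (ltnW (ltn_ord l)).
rewrite -(integral_nnmfunB nu setT _ _ _ _ measurableT (w _ Fp) (w _ Fn) wp.1 wn.1).
by apply: eq_integral => x _; apply: semigroup_signed; case: GP.
Qed.

End limit.
End conditional_mean.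

Theorem theorem6p1 (R : realType) (dE dO : measure_display)
    (E : measurableType dE) (Omega : measurableType dO)
    (X : nat -> Omega -> option E) (P : R.-pker (option E) ~> Omega)
    (t : nat) (A : nat -> set E)
    (V eta : E -> R) (theta0 CQ alpha : R) (nu : probability E R) :
  absorbed_markov_chain X P ->
  periodicity X P t A ->
  assumptionH X P t A V eta theta0 CQ alpha nu ->
  exists C : R,
    forall (f : E -> R) (mu : probability E R) (N : nat),
      measurable_fun setT f ->
      (forall x, (-1 <= f x <= 1)%R) ->
      (exists2 i, (i < t)%N &
        0 < \int[mu]_(x in A i) eta_ X P eta theta0 (t - i) x) ->
      (forall i, (i < t)%N ->
        \int[mu]_(x in A i) semigroup X P (t - i) (EFin \o V) x < +oo) ->
      `| cond_expectation (initial_law P mu)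
           (fun w => (N.+1%:R^-1)%:E
                     * \sum_(0 <= m < N.+1) ext0 (EFin \o f) (X m w))
           (alive R X N)
         - (theta0 ^- t / t%:R)%:E
           * \sum_(0 <= l < t)
               \int[nu]_x semigroup X P l
                 (fun y => (f y)%:E * semigroup X P (t - l) (EFin \o eta) y) x |
      <= (C%:E * \sum_(0 <= i < t)
                   \int[mu]_(x in A i) semigroup X P (t - i) (EFin \o V) x)
         / (N.+1%:R%:E * \sum_(0 <= i < t)
                   \int[mu]_(x in A i) eta_ X P eta theta0 (t - i) x).
Proof.
move=> XP AP HP.
have [M [M0 etaM]] := eta_le_V _ _ _ _ _ _ _ _ _ _ HP.
have [c [c0 cp]] := survival_mass_lower _ _ _ _ _ _ _ _ _ _ XP AP HP.
(* The factor 2 pays for applying [ratio_error] to the positive and to the negative part of [f]. *)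
exists (2 * ratio_const t V theta0 CQ alpha nu M c)%R => f mu N mf f1 eta_pos Vfin.
have class_etaE (i : 'I_t) := class_etaE _ _ _ _ _ _ _ _ _ _ XP AP HP _ M0 etaM mu i
  (ltn_ord i) (Vfin _ (ltn_ord i)).
have VE : \sum_(0 <= i < t) \int[mu]_(x in A i) semigroup X P (t - i) (EFin \o V) x =
    (\sum_(i < t) class_V X P t A V mu i)%:E.
  rewrite big_mkord -sumEFin; apply: eq_bigr => i _.
  exact: (class_VE _ _ _ _ _ _ _ _ _ _ XP HP mu i (Vfin _ (ltn_ord i))).1.
have th_ge0 k : (0 <= theta0 ^- k)%R by rewrite invr_ge0 exprn_ge0// ltW// (theta0_gt0 HP).
have etaE (i : 'I_t) : \int[mu]_(x in A i) eta_ X P eta theta0 (t - i) x =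
    (theta0 ^- (t - i) * class_eta X P t A eta mu i)%:E.
  rewrite EFinM -(class_etaE i).1.
  have etaP := nnmfun_eta _ _ _ _ _ _ _ _ _ _ HP.
  have [S0 mS] := nnmfun_semigroup _ _ XP (t - i) _ etaP.
  rewrite -ge0_integralZl ?lee_fin//.
  - exact: class_measurable AP _ (ltn_ord i).
  - exact: measurable_funTS.
have sum_etaE : \sum_(0 <= i < t) \int[mu]_(x in A i) eta_ X P eta theta0 (t - i) x =
    (\sum_(i < t) theta0 ^- (t - i) * class_eta X P t A eta mu i)%:E.
  by rewrite big_mkord -sumEFin; apply: eq_bigr => i _; exact: etaE.
(* One class with positive eta-mass is enough, the other terms being nonnegative. *)
have sum_gt0 : (0 < \sum_(i < t) theta0 ^- (t - i) * class_eta X P t A eta mu i)%R.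
  have [i it] := eta_pos; rewrite (etaE (Ordinal it)) lte_fin => ei.
  rewrite (bigD1 (Ordinal it))//= ltr_wpDr//; apply: sumr_ge0 => j _.
  by rewrite mulr_ge0//; have [_ /andP[]] := class_etaE j.
have mF : measurable_fun setT (EFin \o f) by exact/measurable_EFinP.
have mFp : measurable_fun setT (EFin \o f)^\+ by exact: measurable_funepos.
have mFn : measurable_fun setT (EFin \o f)^\- by exact: measurable_funeneg.
have F0 := funepos01 _ f1; have F1 := funeneg01 _ f1.
have D0 := surv_gt0 _ _ _ _ _ _ _ _ _ _ XP AP HP _ _ M0 etaM c0 cp _ mFp F0 mu Vfin
  sum_gt0 N.
rewrite (cond_expectation_visits _ _ _ _ XP AP _ _ mf f1 _ D0).
rewrite (limit_signed _ _ _ _ _ _ _ _ _ _ XP AP HP _ mf f1 _ M0 etaM).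
have hp := ratio_error _ _ _ _ _ _ _ _ _ _ XP AP HP _ _ M0 etaM c0 cp _ mFp F0 mu Vfin
  sum_gt0 N.
have hn := ratio_error _ _ _ _ _ _ _ _ _ _ XP AP HP _ _ M0 etaM c0 cp _ mFn F1 mu Vfin
  sum_gt0 N.
rewrite VE sum_etaE -!EFinM inver gt_eqF ?mulr_gt0// -EFinM -EFinB lee_fin.
set u := (occ _ _ _ _ _ _ _ / _)%R in hp *; set v := (occ _ _ _ _ _ _ _ / _)%R in hn *.
set Lp := mean_limit _ _ _ _ _ _ _ in hp *; set Ln := mean_limit _ _ _ _ _ _ _ in hn *.
have -> : (u - v - (Lp - Ln) = (u - Lp) - (v - Ln))%R by ring.
apply: (le_trans (ler_normB _ _)); apply: (le_trans (lerD hp hn)).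
by rewrite -!mulrA (mulr_natl _ 2) mulr2n.
Qed.
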